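(* Let $n\ge 22$ be an integer. Then $$\mathrm{ex}(n,K_3,C_3^3)\le \frac{n^2}{4}-1+\mathbf{1}_{4\mid n},$$ where $\mathbf{1}_{4\mid n}$ equals $1$ if $4$ divides $n$ and $0$ otherwise. Furthermore, equality holds when $n$ is even, and in that case $M_{\lceil n/4\rceil}+M_{\lfloor n/4\rfloor}$ is the unique extremal graph, i.e. it is, up to isomorphism, the unique $n$-vertex $C_3^3$-free graph containing exactly $\mathrm{ex}(n,K_3,C_3^3)$ triangles.
   Context: All graphs are finite and simple. For graphs $T$ and $H$, a graph is $H$-free if it contains no (not necessarily induced) subgraph isomorphic to $H$, and the generalized Turán number $\mathrm{ex}(n,T,H)$ is the maximum number of copies of $T$ (subgraphs isomorphic to $T$) in an $n$-vertex $H$-free graph; thus $\mathrm{ex}(n,K_3,H)$ is the maximum number of triangles in an $n$-vertex $H$-free graph. For a graph $H$ and an integer $p>2$, the edge blow-up $H^p$ is the graph obtained from $H$ by replacing each edge of $H$ by a copy of $K_p$ containing that edge, where the $p-2$ new vertices of each clique are distinct from the vertices of $H$ and from the new vertices of all other cliques. $C_k$ denotes the cycle with $k$ edges, so $C_3^3$ is the 6-vertex graph consisting of a triangle $xyz$ together with three further distinct vertices $x',y',z'$, where $x'$ is adjacent to $y,z$; $y'$ is adjacent to $x,z$; and $z'$ is adjacent to $x,y$. $M_k$ denotes the matching with $k$ edges (on $2k$ vertices). $G+H$ denotes the join of $G$ and $H$: the graph obtained from the disjoint union of $G$ and $H$ by adding all edges with one endvertex in $V(G)$ and the other in $V(H)$.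 *)

(* Defs.v *)
From HB Require Import structures.
From mathcomp Require Import all_boot.

Set Implicit Arguments.
Unset Strict Implicit.
Unset Printing Implicit Defensive.

Local Open Scope nat_scope.

(* A simple graph on the vertex type V is a set of 2-element subsets of V;
   being a subtype of {set {set V}}, the type of all such graphs is finite. *)
Record sgraph (V : finType) : predArgType := SGraph {
  edges : {set {set V}};
  edges_card2 : [forall e in edges, #|e| == 2] }.

HB.instance Definition _ (V : finType) := [isSub of sgraph V for @edges V].
HB.instance Definition _ (V : finType) := [Finite of sgraph V by <:].

Definition adj (V : finType) (G : sgraph V) : rel V :=
  fun x y => [set x; y] \in edges G.

(* The underlying simple graph of an arbitrary relation: loops and orientation
   are forgotten, see adj_graph_of. *)
Definition graph_of_edges (V : finType) (r : rel V) : {set {set V}} :=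
  [set e | [exists x, exists y, [&& x != y, r x y & e == [set x; y]]]].

Lemma graph_of_edges_card2 (V : finType) (r : rel V) :
  [forall e in graph_of_edges r, #|e| == 2].
Proof.
apply/forall_inP => e; rewrite inE => /existsP[x /existsP[y /and3P[xy _ /eqP->]]].
by rewrite cards2 xy.
Qed.

Definition graph_of (V : finType) (r : rel V) : sgraph V :=
  SGraph (graph_of_edges_card2 r).

Lemma adj_graph_of (V : finType) (r : rel V) (x y : V) :
  adj (graph_of r) x y = (x != y) && (r x y || r y x).
Proof.
rewrite /adj /= inE; apply/idP/idP.
  case/existsP=> a /existsP[b /and3P[ab rab /eqP exy]].
  have /set2P ha : a \in [set x; y] by rewrite exy set21.
  have /set2P hb : b \in [set x; y] by rewrite exy set22.
  case: ha hb => ea [] eb; rewrite ea eb ?eqxx // in ab rab.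
    by rewrite ab rab.
  by rewrite eq_sym ab rab orbT.
case/andP=> xy /orP[] h.
  by apply/existsP; exists x; apply/existsP; exists y; rewrite xy h eqxx.
apply/existsP; exists y; apply/existsP; exists x.
by rewrite eq_sym xy h setUC eqxx.
Qed.

Definition isomorphic (V W : finType) (G : sgraph V) (H : sgraph W) : Prop :=
  exists2 f : V -> W, bijective f & forall x y, adj G x y = adj H (f x) (f y).

(* The copies of T in G: the subgraphs (vertex set, edge set) of G that are the
   image of T under an injective map of vertices. *)
Definition copies (U V : finType) (T : sgraph U) (G : sgraph V) :
    {set {set V} * {set {set V}}} :=
  [set S : {set V} * {set {set V}} | (S.2 \subset edges G) &&
    [exists f : {ffun U -> V}, [&& injectiveb f, S.1 == f @: [set: U] &
      S.2 == [set f @: (e : {set U}) | e in edges T]]]].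

Definition is_free (W V : finType) (H : sgraph W) (G : sgraph V) : bool :=
  copies H G == set0.

(* The generalized Turan number ex(n, T, H). *)
Definition gen_turan (n : nat) (U W : finType) (T : sgraph U) (H : sgraph W) :
    nat :=
  \max_(G : sgraph 'I_n | is_free H G) #|copies T G|.

Definition extremal (n : nat) (U W : finType) (T : sgraph U) (H : sgraph W)
    (V : finType) (G : sgraph V) : Prop :=
  [/\ #|V| = n, is_free H G & #|copies T G| = gen_turan n T H].

Definition complete_graph (r : nat) : sgraph 'I_r := graph_of (fun _ _ => true).

(* ordS i is i + 1 modulo k; this is the cycle C_k for k >= 3. *)
Definition cycle_graph (k : nat) : sgraph 'I_k :=
  graph_of (fun i j => j == ordS i).

Definition matching_graph (k : nat) : sgraph ('I_k * bool)%type :=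
  graph_of (fun x y => x.1 == y.1).

Definition join_graph (V W : finType) (G : sgraph V) (H : sgraph W) :
    sgraph (V + W)%type :=
  graph_of (fun x y => match x, y with
    | inl a, inl b => adj G a b
    | inr a, inr b => adj H a b
    | _, _ => true
    end).

(* Vertices of the edge blow-up H^p (p > 2): those of H, and p - 2 new vertices
   (e, i) for each edge e of H. *)
Definition blowup_vertex (W : finType) (p : nat) (H : sgraph W) : finType :=
  (W + {e : {set W} | e \in edges H} * 'I_(p - 2))%type.

Definition blowup_clique (W : finType) (p : nat) (H : sgraph W)
    (e : {e : {set W} | e \in edges H}) : {set blowup_vertex p H} :=
  [set u | match u with inl w => w \in val e | inr v => v.1 == e end].

Definition blowup (W : finType) (p : nat) (H : sgraph W) :
    sgraph (blowup_vertex p H) :=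
  graph_of (fun u v => [exists e : {e : {set W} | e \in edges H},
    (u \in blowup_clique p e) && (v \in blowup_clique p e)]).

(* Main.v *)
Require Import Defs.
From mathcomp Require Import all_boot all_order all_algebra.
From mathcomp Require Import zify ring.

(** The forbidden graph is the 3-sun: a triangle xyz with a further triangle on each
    of its edges, whose three outer vertices are distinct.  A sun-free graph has few
    triangles because there are no more of them than edges lying in at most three
    triangles.

    For a triangle xyz, the sets of vertices other than x, y, z that complete the
    edges yz, xz and xy have no system of distinct representatives
    ([triangle_no_sdr]).  By Hall's condition in this tiny case, the codegrees of
    the three edges cannot be large simultaneously: give an edge of codegree 1, 2
    or 3 the weight 1, 1/2 or 1/3, and an edge of larger codegree the weight 0;
    then every triangle has weight at least 1 ([weight_triangle]).  An edge of
    weight 1/c lies in c triangles, so double counting shows that the number t of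
    triangles is at most the number of light edges, those of codegree at most 3
    ([ordered_triangles_light]).

    The graph L of light edges has at most n^2/4 edges.  If it is triangle-free,
    this is Mantel's theorem.  Otherwise, the same Hall argument shows that the
    vertices of a light triangle send at most n + 1 light edges to the rest
    ([light_triangle_deletion]), so deleting vertex-disjoint light triangles one
    by one leaves a bound below n^2/4 - 1 as soon as n >= 22 and one triangle has
    been deleted ([light_triangle_free]).  This is where 22 comes from: deleting
    about n/3 triangles changes n^2/4 by n(22 - n)/12.

    Suppose now that t >= n^2/4 - 1.  Then L is triangle-free with almost n^2/4
    edges, hence bipartite with parts A and B ([mantel_stability]) and missing at
    most one pair of A x B.  Edges inside a part are then heavy, so there is no
    triangle inside a part, and t is half the sum of the codegrees over the
    cross edges ([ordered_triangles_cross]).  A vertex with two neighbours in its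
    own part forces the other part to have no edges and its own part to be a star
    forest, which yields too few triangles ([inner_degree_le1]).  So both
    parts induce matchings, and counting again shows that these are perfect and
    that all cross edges are present ([matching_join_of_cross_weight]).  The graph
    is thus the join of two perfect matchings, with t = |A| |B|, both factors
    even; t >= n^2/4 - 1 then leaves exactly the balanced choice, and no choice if
    n is odd.  Conversely such a join contains no 3-sun
    ([matching_join_sun_free]).

    All counts are made on ordered pairs and triples of vertices, which turns
    double counting into exchanging sums: an edge is counted twice and a triangle
    six times. *)

Set Implicit Arguments.
Unset Strict Implicit.
Unset Printing Implicit Defensive.

Local Open Scope nat_scope.

(** * Mantel's theorem and its stability *)

Section Mantel.
Variables (V : finType) (e : rel V).
Hypothesis e_sym : symmetric e.
Implicit Types (A B S : {set V}) (x y z : V).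

Definition arcs (A B : {set V}) : nat := \sum_(x in A) \sum_(y in B) e x y.

Definition triangle_free_on (S : {set V}) : Prop :=
  forall x y z, x \in S -> y \in S -> z \in S -> e x y -> e y z -> e x z -> False.

Lemma arcsC A B : arcs A B = arcs B A.
Proof.
rewrite /arcs exchange_big; apply: eq_bigr => x _; apply: eq_bigr => y _.
by rewrite e_sym.
Qed.

Lemma arcsDr A B S : A \subset S -> arcs B S = arcs B A + arcs B (S :\: A).
Proof.
move=> sAS; rewrite /arcs -big_split; apply: eq_bigr => x _.
by rewrite (big_setID A) /= (setIidPr sAS).
Qed.

Lemma arcs_split A S : A \subset S ->
  arcs S S = arcs A A + 2 * arcs (S :\: A) A + arcs (S :\: A) (S :\: A).
Proof.
move=> sAS; rewrite (arcsDr S sAS) (arcsC S A) (arcsC S (S :\: A)).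
by rewrite !(arcsDr _ sAS) (arcsC A (S :\: A)); lia.
Qed.

Lemma leq_arcs A B : arcs A B <= #|A| * #|B|.
Proof.
rewrite -sum_nat_const leq_sum // => x _; rewrite -sum1_card leq_sum // => y _.
exact: leq_b1.
Qed.

Lemma arcs_eq0 A B : (forall x y, x \in A -> y \in B -> ~~ e x y) -> arcs A B = 0.
Proof.
move=> h; rewrite /arcs !big1 // => x xA; rewrite big1 // => y yB.
by rewrite (negPf (h x y xA yB)).
Qed.

Lemma sum_row_card (A : {set V}) x : \sum_(y in A) e x y = #|[set y in A | e x y]|.
Proof.
by rewrite -sum1_card big_mkcond /= [RHS]big_mkcond; apply: eq_bigr => y _;
  rewrite inE; case: (y \in A); case: (e x y).
Qed.

(** The neighbourhood of a vertex of maximum degree: it is independent since the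
    graph is triangle-free, and its size bounds all degrees. *)
Lemma max_neighbourhood S : triangle_free_on S ->
  exists A, [/\ A \subset S, forall x y, x \in A -> y \in A -> ~~ e x y &
    forall x, x \in S -> #|[set y in S | e x y]| <= #|A|].
Proof.
move=> tfS; have [->|[x0 x0S]] := set_0Vmem S.
  by exists set0; split=> [|x y|x]; rewrite ?sub0set ?inE.
have [x xS xmax] := @arg_maxnP _ x0 (mem S) (fun x => #|[set y in S | e x y]|) x0S.
exists [set y in S | e x y]; split=> //.
  by apply/subsetP => y; rewrite inE => /andP[].
move=> y z; rewrite !inE => /andP[yS exy] /andP[zS exz]; apply/negP => eyz.
exact: (tfS x y z).
Qed.

(** Every edge has an endpoint outside an independent set A, so summing the degrees
    of the vertices outside A counts the edges, those avoiding A twice. *)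
Lemma arcs_independent A S : A \subset S ->
    (forall x y, x \in A -> y \in A -> ~~ e x y) ->
  arcs S S + arcs (S :\: A) (S :\: A) = 2 * arcs (S :\: A) S.
Proof.
move=> sAS Aind; rewrite (arcs_split sAS) (arcs_eq0 Aind) (arcsDr _ sAS); lia.
Qed.

Lemma arcs_max_degree A B S : B \subset S ->
    (forall x, x \in S -> #|[set y in S | e x y]| <= #|A|) ->
  arcs B S <= #|B| * #|A|.
Proof.
move=> sBS Amax; rewrite -sum_nat_const leq_sum // => x xB.
by rewrite sum_row_card Amax // (subsetP sBS).
Qed.

(** With A a neighbourhood of maximum size, the edges are at most the sum of the
    degrees outside A, hence at most |A| (|S| - |A|). *)
Lemma mantel S : triangle_free_on S -> 2 * arcs S S <= #|S| ^ 2.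
Proof.
move=> /max_neighbourhood[A [sAS Aind Amax]].
have := arcs_independent sAS Aind.
have := arcs_max_degree (subsetDl S A) Amax.
have := cardsID A S; rewrite (setIidPr sAS) => <-.
have := nat_AGM2 #|A| #|S :\: A|; rewrite mulnC /leqif => -[]; lia.
Qed.

(** In the proof of Mantel's theorem, each edge outside A costs one, so at most one
    such edge yz survives.  The neighbourhoods of y and z in A are disjoint, which
    loses about n/2 edges and rules out even that one. *)
Lemma mantel_stability : 7 <= #|V| -> triangle_free_on setT ->
    #|V| ^ 2 <= 2 * arcs setT setT + 4 ->
  exists A : {set V}, forall x y, e x y -> (x \in A) = (y \notin A).
Proof.
move=> n7 tf large; have [A [_ Aind Amax]] := max_neighbourhood tf.
exists A; set B := setT :\: A.
have sAT : A \subset setT by rewrite subsetT.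
have eqn := arcs_independent sAT Aind; rewrite -/B in eqn.
have le_BA := arcs_max_degree (subsetT B) Amax.
have cardAB : #|A| + #|B| = #|V|.
  by rewrite -[#|V|]cardsT -(cardsID A setT) setTI.
have BB2 : arcs B B <= 2.
  have := nat_AGM2 #|B| #|A|; rewrite addnC cardAB => -[]; lia.
have Bind y z : y \in B -> z \in B -> ~~ e y z.
  move=> yB zB; apply/negP => eyz; have eyy := tf y y y (in_setT _) (in_setT _) (in_setT _).
  have yz : y != z by apply/eqP=> yz; apply: eyy; rewrite {2}yz.
  have BA : arcs B A <= (#|B| - 1) * #|A|.
    pose d i := \sum_(x in A) (e i x : nat).
    rewrite -[arcs B A]/(\sum_(i in B) d i) (bigD1 y) //= (bigD1 z) /=; last first.
      by rewrite zB eq_sym.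
    rewrite addnA.
    have rows : d y + d z <= #|A|.
      rewrite -big_split -sum1_card leq_sum // => x xA /=.
      case eyx: (e y x); case ezx: (e z x) => //.
      by case: (tf y z x (in_setT _) (in_setT _) (in_setT _)).
    have cardB : #|B| = #|B :\ y :\ z| + 2.
      by rewrite (cardsD1 y) (cardsD1 z) in_setD1 yB zB eq_sym yz; lia.
    have rest : \sum_(i in B | (i != y) && (i != z)) d i <= (#|B| - 2) * #|A|.
      rewrite cardB addnK -sum_nat_const.
      rewrite (eq_bigl [in B :\ y :\ z]) => [|i]; last first.
        by rewrite !in_setD1 andbC andbA [(i != y) && _]andbC.
      apply: leq_sum => i _; rewrite -sum1_card.
      by apply: leq_sum => x _; exact: leq_b1.
    have -> : #|B| - 1 = (#|B| - 2).+1 by rewrite cardB; lia.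
    rewrite mulSn; apply: leq_add rows _.
    by under eq_bigl => i do rewrite -andbA.
  have := arcs_split sAT; rewrite (arcs_eq0 Aind) -/B => arcsE.
  have B1 : 0 < #|B| by rewrite card_gt0; apply/set0Pn; exists y.
  have [] := nat_AGM2 (#|B| - 1) #|A|.
  have -> : #|B| - 1 + #|A| = #|V| - 1 by lia.
  have : #|V| ^ 2 + 1 = (#|V| - 1) ^ 2 + 2 * #|V|.
    case: #|V| n7 => // m _; rewrite subn1 /= -!mulnn mulSn mulnS; clear; lia.
  move: BA large BB2 arcsE; move: (arcs B A) => p; move: (_ * #|A|) => q.
  move: (#|V| ^ 2) ((#|V| - 1) ^ 2) => r t; lia.
move=> x y exy; case xA: (x \in A); case yA: (y \in A) => //.
  by have := Aind x y xA yA; rewrite exy.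
by have := Bind x y; rewrite !inE xA yA exy => /(_ isT isT).
Qed.
End Mantel.

(** * Three sets without distinct representatives *)

Section DistinctRepresentatives.
Variable V : finType.
Implicit Types X Y Z : {set V}.

Definition no_sdr X Y Z : Prop := forall x y z,
  x \in X -> y \in Y -> z \in Z -> x != y -> y != z -> x != z -> False.

Lemma no_sdr_rot X Y Z : no_sdr X Y Z -> no_sdr Y Z X.
Proof.
by move=> h y z x yY zZ xX yz zx yx; apply: (h x y z); rewrite // eq_sym.
Qed.

(** A set of size three always has an element left once the two other
    representatives are chosen. *)
Lemma no_sdr_large X Y Z y z : no_sdr X Y Z -> 2 < #|X| ->
  y \in Y -> z \in Z -> y = z.
Proof.
move=> h X3 yY zZ; apply/eqP/negP => /negP yz.
have /card_gt0P[x] : 0 < #|X :\ y :\ z|.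
  have := cardsD1 y X; have := cardsD1 z (X :\ y); lia.
rewrite !in_setD1 => /and3P[xz xy xX]; exact: (h x y z).
Qed.

(** Six times the reciprocal of c if c is 1, 2 or 3; the factor avoids fractions. *)
Definition weight (c : nat) : nat := if c <= 3 then 6 %/ c else 0.

Lemma weight_le c : c * weight c <= 6.
Proof. by rewrite /weight; case: ifP => _; rewrite ?muln0 // mulnC leq_divM. Qed.

(** The successors stand for codegrees, which also count the third vertex of the
    triangle.  If all sizes are at most two, each weight is at least 2.  A larger
    set contributes 0, but by [no_sdr_large] it makes another set empty (weight 6)
    or the two others singletons (weight 3 each). *)
Lemma no_sdr_weight X Y Z : no_sdr X Y Z ->
  6 <= weight #|X|.+1 + weight #|Y|.+1 + weight #|Z|.+1.
Proof.
have aux (X' Y' Z' : {set V}) : no_sdr X' Y' Z' -> 2 < #|X'| ->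
    [\/ #|Y'| = 0, #|Z'| = 0 | #|Y'| = 1 /\ #|Z'| = 1].
  move=> h X3.
  have [->|[y yY]] := set_0Vmem Y'; first by rewrite cards0; constructor.
  have [->|[z zZ]] := set_0Vmem Z'; first by rewrite cards0; constructor.
  have eqYZ u v : u \in Y' -> v \in Z' -> u = v := @no_sdr_large _ _ _ _ _ h X3.
  constructor 3.
  have -> : Y' = [set z].
    apply/setP => u; rewrite inE; apply/idP/eqP => [uY|->]; first exact: eqYZ.
    by rewrite -(eqYZ y z).
  have -> : Z' = [set y].
    apply/setP => u; rewrite inE; apply/idP/eqP => [uZ|->]; first by rewrite (eqYZ y u).
    by rewrite (eqYZ y z).
  by rewrite !cards1.
move=> h; have hX := aux _ _ _ h.
have hY := aux _ _ _ (no_sdr_rot h).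
have hZ := aux _ _ _ (no_sdr_rot (no_sdr_rot h)).
have w1 : weight 1 = 6 by [].
have w2 : weight 2 = 3 by [].
case: (ltnP 2 #|X|) => [/hX[->|->|[-> ->]]|X2]; rewrite ?w1 ?w2; try lia.
case: (ltnP 2 #|Y|) => [/hY[->|->|[-> ->]]|Y2]; rewrite ?w1 ?w2; try lia.
case: (ltnP 2 #|Z|) => [/hZ[->|->|[-> ->]]|Z2]; rewrite ?w1 ?w2; try lia.
by move: #|X| #|Y| #|Z| X2 Y2 Z2 => [|[|[|?]]] [|[|[|?]]] [|[|[|?]]].
Qed.

(** This quantity is, for the three completing sets of a triangle, the excess of
    the number of edges leaving the triangle over one edge per outer vertex.  If it
    were at least 5, the union would have at least four elements, which leaves
    enough room to choose representatives. *)
Lemma no_sdr_cover X Y Z : no_sdr X Y Z ->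
  #|X| <= 2 -> #|Y| <= 2 -> #|Z| <= 2 -> #|X :|: Y :|: Z| + #|X :&: Y :&: Z| <= 4.
Proof.
move=> h X2 Y2 Z2; rewrite leqNgt; apply/negP => big.
have I1 : #|X :&: Y :&: Z| <= 1.
  rewrite leqNgt; apply/negP => I2.
  have sub (W : {set V}) : #|W| <= 2 -> X :&: Y :&: Z \subset W -> W = X :&: Y :&: Z.
    by move=> W2 sW; apply/esym/eqP; rewrite eqEcard sW; lia.
  have eqX : X = X :&: Y :&: Z by apply: sub; rewrite // -setIA subsetIl.
  have eqY : Y = X :&: Y :&: Z by apply: sub; rewrite // setIAC subsetIr.
  have eqZ : Z = X :&: Y :&: Z by apply: sub; rewrite // subsetIr.
  have YX : Y = X by rewrite eqY -eqX.
  have ZX : Z = X by rewrite eqZ -eqX.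
  by move: big; rewrite YX ZX !setUid !setIid; lia.
have IX : #|X :&: Y :&: Z| <= #|X| by rewrite -setIA subset_leq_card ?subsetIl.
have IY : #|X :&: Y :&: Z| <= #|Y| by rewrite setIAC subset_leq_card ?subsetIr.
have IZ : #|X :&: Y :&: Z| <= #|Z| by rewrite subset_leq_card ?subsetIr.
have UYZ : #|X :|: Y :|: Z| + #|Y :&: Z| <= #|X| + #|Y| + #|Z|.
  rewrite -setUA; have := cardsUI Y Z; have := cardsUI X (Y :|: Z); lia.
have UXYZ : #|X :|: Y :|: Z| <= #|X| + #|Y :|: Z|.
  by rewrite -setUA; have := cardsUI X (Y :|: Z); lia.
have /card_gt0P[x xX] : 0 < #|X| by lia.
have /card_gt0P[y yY] : 0 < #|Y| by lia.
have /card_gt0P[z zZ] : 0 < #|Z| by lia.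
have pick (W : {set V}) u : 2 <= #|W| -> exists2 v, v \in W & v != u.
  move=> W2; have /card_gt0P[v] : 0 < #|W :\ u| by have := cardsD1 u W; lia.
  by rewrite in_setD1 => /andP[? ?]; exists v.
have {y z yY zZ} [y [z [yY zZ yz]]] : exists y z, [/\ y \in Y, z \in Z & y != z].
  have [yz|?] := eqVneq y z; last by exists y, z.
  subst z; have [v] : exists2 v, v \in Y :|: Z & v != y by apply: pick; lia.
  by case/setUP=> [vY|vZ] vy; [exists v, y|exists y, v]; split; rewrite // eq_sym.
have Xyz u : u \in X -> (u == y) || (u == z).
  move=> uX; apply/norP => -[uy uz]; exact: (h u y z).
have sX : X \subset Y :|: Z.
  by apply/subsetP => u /Xyz /orP[/eqP->|/eqP->]; rewrite in_setU ?yY ?zZ ?orbT.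
move: big; rewrite -setUA (setUidPr sX) => big.
have := cardsUI Y Z => cardYZ.
have YZ u : u \in Y -> u \in Z -> False.
  move=> uY uZ; have : 0 < #|Y :&: Z| by apply/card_gt0P; exists u; rewrite inE uY.
  lia.
have [u uY uy] : exists2 u, u \in Y & u != y by apply: pick; lia.
have [v vZ vz] : exists2 v, v \in Z & v != z by apply: pick; lia.
have uz : u != z by apply/eqP => uz; apply: (YZ u); rewrite // uz.
have yv : y != v by apply/eqP => yv; apply: (YZ y); rewrite // yv.
case/orP: (Xyz x xX) => /eqP xE.
  by apply: (h x u z); rewrite // xE // eq_sym.
by apply: (h x y v); rewrite // xE // eq_sym.
Qed.
End DistinctRepresentatives.

(** * Triangles and light edges in sun-free graphs *)

Section Triangles.
Variables (V : finType) (g : rel V).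
Hypotheses (g_sym : symmetric g) (g_irr : irreflexive g).
Implicit Types (A B S : {set V}) (x y z : V).

(** The third vertices of the triangles on the edge xy. *)
Definition conbr x y : {set V} := [set z | g x z && g y z].

Definition codeg x y : nat := #|conbr x y|.

(** Freeness from the 3-sun, spelled out on the six vertices of a copy; see
    [is_free_sunP]. *)
Definition sun_free : Prop := forall x y z x' y' z',
  uniq [:: x; y; z; x'; y'; z'] -> g x y -> g y z -> g x z ->
  x' \in conbr y z -> y' \in conbr x z -> z' \in conbr x y -> False.

Definition triangle x y z : bool := [&& g x y, g y z & g x z].

Definition light : rel V := fun x y => g x y && (codeg x y <= 3).

Definition sum3 (F : V -> V -> V -> nat) : nat := \sum_x \sum_y \sum_z F x y z.

Definition ordered_triangles : nat := sum3 triangle.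

Lemma edge_neq x y : g x y -> x != y.
Proof. by apply: contraTneq => ->; rewrite g_irr. Qed.

Lemma conbrC x y : conbr x y = conbr y x.
Proof. by apply/setP => z; rewrite !inE andbC. Qed.

Lemma codegC x y : codeg x y = codeg y x.
Proof. by rewrite /codeg conbrC. Qed.

Lemma light_sym : symmetric light.
Proof. by move=> x y; rewrite /light g_sym codegC. Qed.

Lemma triangleC12 x y z : triangle y x z = triangle x y z.
Proof.
rewrite /triangle (g_sym y x) andbCA andbC -andbA andbCA.
by congr andb; rewrite andbC.
Qed.

Lemma triangle_rot x y z : triangle y z x = triangle x y z.
Proof. by rewrite /triangle (g_sym z x) (g_sym y x) andbA andbC andbA. Qed.

Lemma sum3C12 F : sum3 F = sum3 (fun x y z => F y x z).
Proof. by rewrite /sum3 exchange_big. Qed.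

Lemma sum3_rot F : sum3 F = sum3 (fun x y z => F y z x).
Proof.
rewrite /sum3 [RHS]exchange_big; apply: eq_bigr => x _ /=.
by rewrite [RHS]exchange_big.
Qed.

Lemma eq_sum3 F1 F2 : (forall x y z, F1 x y z = F2 x y z) -> sum3 F1 = sum3 F2.
Proof.
by move=> eqF; do 3!apply: eq_bigr => ? _; rewrite eqF.
Qed.

Lemma leq_sum3 F1 F2 : (forall x y z, F1 x y z <= F2 x y z) -> sum3 F1 <= sum3 F2.
Proof. by move=> leF; do 3!apply: leq_sum => ? _; rewrite leF. Qed.

Lemma sum3D F1 F2 : sum3 (fun x y z => F1 x y z + F2 x y z) = sum3 F1 + sum3 F2.
Proof.
rewrite /sum3 -big_split; apply: eq_bigr => x _ /=; rewrite -big_split.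
by apply: eq_bigr => y _ /=; rewrite -big_split.
Qed.

Lemma sum3_triangle (f : V -> V -> nat) :
  sum3 (fun x y z => triangle x y z * f x y) = \sum_x \sum_y g x y * (codeg x y * f x y).
Proof.
apply: eq_bigr => x _; apply: eq_bigr => y _.
rewrite -big_distrl /= mulnA; congr (_ * _).
rewrite /codeg -sum1_card big_distrr [RHS]big_mkcond /=; apply: eq_bigr => z _.
by rewrite inE /triangle; case: (g x y); case: (g y z); case: (g x z).
Qed.

Lemma sum3Ml c F : sum3 (fun x y z => c * F x y z) = c * sum3 F.
Proof.
rewrite /sum3 big_distrr; apply: eq_bigr => x _; rewrite big_distrr.
by apply: eq_bigr => y _; rewrite big_distrr.
Qed.

(** Double counting of a weight on edges over the triangles containing them. *)
Lemma sum3_triangle_edges (f : V -> V -> nat) :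
  sum3 (fun x y z => triangle x y z * (f x y + f y z + f x z)) =
    3 * \sum_x \sum_y g x y * (codeg x y * f x y).
Proof.
pose F x y z := triangle x y z * f x y; rewrite -sum3_triangle -/F.
have <- : sum3 F + sum3 (fun x y z => F y z x) + sum3 (fun x y z => F x z y) = 3 * sum3 F.
  have <- : sum3 F = sum3 (fun x y z => F y z x) by rewrite [LHS]sum3_rot.
  have <- : sum3 F = sum3 (fun x y z => F x z y); last by lia.
  by rewrite [LHS]sum3_rot [LHS]sum3C12.
rewrite -!sum3D; apply: eq_sum3 => x y z; rewrite /F (triangle_rot x y z).
have -> : triangle x z y = triangle x y z by rewrite -triangleC12 2!triangle_rot.
by rewrite !mulnDr.
Qed.

Hypothesis g_sun_free : sun_free.

(** Distinct representatives would be the outer vertices of a sun on xyz. *)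
Lemma triangle_no_sdr x y z : triangle x y z ->
  no_sdr (conbr y z :\ x) (conbr x z :\ y) (conbr x y :\ z).
Proof.
move=> /and3P[gxy gyz gxz] x' y' z' /setD1P[xx' x'P] /setD1P[yy' y'P] /setD1P[zz' z'P].
move=> xy' yz' xz'; apply: (g_sun_free (x := x) (y := y) (z := z) _ _ _ _ x'P y'P z'P) => //=.
move: x'P y'P z'P; rewrite !inE => /andP[gyx' gzx'] /andP[gxy' gzy'] /andP[gxz' gyz'].
rewrite !negb_or !andbT xy' yz' xz' (edge_neq gxy) (edge_neq gyz) (edge_neq gxz).
rewrite (edge_neq gyx') (edge_neq gzx') (edge_neq gxy') (edge_neq gzy') (edge_neq gxz') (edge_neq gyz').
by rewrite eq_sym xx' eq_sym yy' eq_sym zz'.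
Qed.

Lemma codeg_triangle x y z : triangle x y z -> codeg x y = #|conbr x y :\ z|.+1.
Proof.
by case/and3P=> gxy gyz gxz; rewrite /codeg (cardsD1 z) inE gxz gyz.
Qed.

Lemma triangle_codegs x y z : triangle x y z ->
  [/\ codeg y z = #|conbr y z :\ x|.+1, codeg x z = #|conbr x z :\ y|.+1 &
      codeg x y = #|conbr x y :\ z|.+1].
Proof.
move=> t; split; apply: codeg_triangle => //; first by rewrite triangle_rot.
by rewrite -triangleC12 2!triangle_rot.
Qed.

Lemma weight_triangle x y z : triangle x y z ->
  6 <= weight (codeg y z) + weight (codeg x z) + weight (codeg x y).
Proof.
move=> t; have [-> -> ->] := triangle_codegs t; apply: no_sdr_weight.
exact: triangle_no_sdr.
Qed.

(** Each triangle receives weight at least 6 from its edges, while each light edge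
    distributes at most 6 over its triangles and heavy edges give nothing.  Orders
    matter: 6 ordered triples per triangle against 2 ordered pairs per edge. *)
Lemma ordered_triangles_light : ordered_triangles <= 3 * arcs light setT setT.
Proof.
pose f x y := weight (codeg x y).
have edge_sum : \sum_x \sum_y g x y * (codeg x y * f x y) <= 6 * arcs light setT setT.
  rewrite /arcs big_distrr /=; under [X in _ <= X]eq_bigl do rewrite inE.
  apply: leq_sum => x _; rewrite big_distrr /=; under [X in _ <= X]eq_bigl do rewrite inE.
  apply: leq_sum => y _; rewrite /light /f; case: (g x y) => //=; rewrite mul1n.
  have := weight_le (codeg x y); rewrite /weight; by case: ifP => //= _; rewrite muln0.
suff : 6 * ordered_triangles <= 3 * \sum_x \sum_y g x y * (codeg x y * f x y) by lia.
rewrite -sum3_triangle_edges -sum3Ml; apply: leq_sum3 => x y z.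
case t: (triangle x y z) => //=; rewrite muln1 mul1n.
by have := weight_triangle t; rewrite /f; lia.
Qed.
End Triangles.

(** * The light edges of a sun-free graph *)

Section Peeling.
Variables (V : finType) (g : rel V).
Hypotheses (g_sym : symmetric g) (g_irr : irreflexive g) (g_sun_free : sun_free g).
Implicit Types (A B S : {set V}) (x y z : V).

(** An outer vertex w adjacent to two vertices of the triangle completes an edge of
    it, and if adjacent to all three it completes all three edges.  Hence the
    number of edges from w to the triangle is at most 1, plus 1 if w lies in the
    union of the completing sets, plus 1 if it lies in their intersection;
    [no_sdr_cover] bounds the total excess by 4.  With the 3 edges of the triangle
    this makes |S| + 4 edges. *)
Lemma light_triangle_deletion S x y z : x \in S -> y \in S -> z \in S ->
    light g x y -> light g y z -> light g x z ->
  let S' := S :\: [set x; y; z] in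
  #|S| = #|S'| + 3 /\
  arcs (light g) S S <= arcs (light g) S' S' + 2 * #|S| + 8.
Proof.
move=> xS yS zS lxy lyz lxz S'.
have [[gxy cxy] [gyz cyz] [gxz cxz]] :
    [/\ g x y /\ codeg g x y <= 3, g y z /\ codeg g y z <= 3 & g x z /\ codeg g x z <= 3].
  by split; apply/andP.
have t : triangle g x y z by rewrite /triangle gxy gyz gxz.
have [xy yz xz] : [/\ x != y, y != z & x != z].
  by split; apply: (edge_neq g_irr).
pose T := [set x; y; z].
have sTS : T \subset S.
  by apply/subsetP => u; rewrite !inE => /orP[/orP[]|] /eqP->.
have sumT (F : V -> nat) : \sum_(u in T) F u = F x + F y + F z.
  rewrite /T -setUA big_setU1 ?inE ?negb_or ?xy ?xz //= big_setU1 ?inE //= big_set1.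
  by rewrite addnA.
have cardT : #|T| = 3 by rewrite -sum1_card sumT.
have cardS : #|S| = #|S'| + 3.
  by rewrite -(cardsID T S) (setIidPr sTS) cardT addnC.
split=> //.
rewrite (arcs_split (light_sym g_sym) sTS) -/S'.
have lirr u : light g u u = false by rewrite /light g_irr.
have TT : arcs (light g) T T <= 6.
  rewrite /arcs !sumT !lirr; do 6!(case: (light g _ _)) => //.
pose X := conbr g y z :\ x; pose Y := conbr g x z :\ y; pose Z := conbr g x y :\ z.
have ns : no_sdr X Y Z by apply: triangle_no_sdr.
have [eX eY eZ] := triangle_codegs g_sym t.
have XYZ : #|X :|: Y :|: Z| + #|X :&: Y :&: Z| <= 4.
  by apply: (no_sdr_cover ns); [move: cyz|move: cxz|move: cxy];
     rewrite ?eX ?eY ?eZ.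
have S'T : arcs (light g) S' T <= #|S'| + (#|X :|: Y :|: Z| + #|X :&: Y :&: Z|).
  have cardI (W : {set V}) : \sum_(w in S') (w \in W) <= #|W|.
    rewrite -sum1_card big_mkcond [X in _ <= X]big_mkcond /=; apply: leq_sum => w _.
    by case: (w \in S'); case: (w \in W).
  apply: leq_trans (leq_add (leqnn #|S'|) (leq_add (cardI _) (cardI _))).
  rewrite -sum1_card -!big_split /=; apply: leq_sum => w.
  rewrite sumT !inE !negb_or => /andP[/andP[/andP[wx wy] wz] _].
  have lg u : light g w u <= g u w by rewrite /light g_sym; case: (g u w); rewrite ?leq_b1.
  apply: leq_trans (leq_add (leq_add (lg x) (lg y)) (lg z)) _.
  by rewrite wx wy wz /=; case: (g x w); case: (g y w); case: (g z w).
rewrite {}cardS; move: XYZ TT S'T; clear; lia.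
Qed.

(** The value of k is the number of disjoint light triangles removed greedily until
    none is left.  The bound is (s - 3k)^2 / 4 (Mantel on what remains) plus the
    sum over j < k of s - 3j + 4, times 4 and rearranged. *)
Lemma light_peeling S : exists k, [/\ 3 * k <= #|S|,
  k = 0 -> triangle_free_on (light g) S &
  2 * arcs (light g) S S + 2 * #|S| * k <= #|S| ^ 2 + 3 * k ^ 2 + 22 * k].
Proof.
have [m] := ubnP #|S|; elim: m S => // m IH S ltm.
case: (boolP [exists x in S, [exists y in S, [exists z in S,
    [&& light g x y, light g y z & light g x z]]]]).
  case/exists_inP=> x xS /exists_inP[y yS /exists_inP[z zS /and3P[xy yz xz]]].
  have [cardS del] := light_triangle_deletion xS yS zS xy yz xz.
  case: (IH (S :\: [set x; y; z])) => [|k [k3 _ bound]]; first by lia.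
  exists k.+1; split => //; first by lia.
  move: del bound; rewrite cardS; move: #|_ :\: _| k3 => s k3 del bound.
  have -> : (s + 3) ^ 2 = s ^ 2 + 6 * s + 9 by rewrite sqrnD; lia.
  have -> : k.+1 ^ 2 = k ^ 2 + 2 * k + 1 by rewrite -addn1 sqrnD; lia.
  have -> : 2 * (s + 3) * k.+1 = 2 * s * k + 2 * s + 6 * k + 6 by lia.
  lia.
move=> noT; have tf : triangle_free_on (light g) S.
  move=> x y z xS yS zS xy yz xz; case/negP: noT.
  apply/exists_inP; exists x => //; apply/exists_inP; exists y => //.
  by apply/exists_inP; exists z; rewrite // xy yz xz.
exists 0; split=> //; rewrite !muln0 !addn0.
exact: (mantel (light_sym g_sym) tf).
Qed.

(** For 1 <= k <= n/3 and n >= 22, k (2n - 3k - 22) > 4, so removing even one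
    triangle puts the count of [light_peeling] below n^2 / 4 - 1. *)
Lemma light_triangle_free : 22 <= #|V| ->
    #|V| ^ 2 <= 2 * arcs (light g) setT setT + 4 ->
  triangle_free_on (light g) setT.
Proof.
move=> n22 large; have [k [k3 + bound]] := light_peeling setT.
rewrite cardsT in k3 bound; case: k k3 bound => [_ _|k k3 bound _]; first exact.
exfalso; have {large}bound : 2 * #|V| * k.+1 <= 3 * k.+1 ^ 2 + 22 * k.+1 + 4.
  by move: bound large; move: (_ ^ 2) (arcs _ _ _) => p q; lia.
case: (leqP (2 * #|V|) (3 * k.+1 + 22)) => [|big]; first by lia.
have k4 : k <= 3.
  have : (3 * k.+1 + 23) * k.+1 <= 2 * #|V| * k.+1 by rewrite leq_mul2r; lia.
  by rewrite mulnDl -mulnA mulnn; move: (k.+1 ^ 2) bound => q; lia.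
by case: k k3 big bound k4 => [|[|[|[|k]]]] //; lia.
Qed.
End Peeling.

(** * Counting triangles across a bipartition *)

Section Bipartition.
Variables (V : finType) (g : rel V).
Hypotheses (g_sym : symmetric g) (g_irr : irreflexive g).
Implicit Types (A B S : {set V}) (x y z : V).

(** The part A is an argument because the definition is applied to both parts of a
    bipartition, each time to vertices x of that part. *)
Definition inner_degree A x : nat := \sum_(y in A) g x y.

(** Twice the number of triangles meeting both A and its complement, since each
    of them has two cross edges; see [ordered_triangles_cross]. *)
Definition cross_weight A : nat :=
  \sum_(x in A) \sum_(y in ~: A) g x y * codeg g x y.

Definition no_inner_triangle A : Prop := forall x y z,
  triangle g x y z -> (x \in A) = (y \in A) -> (y \in A) = (z \in A) -> False.

(** The join of a perfect matching on A and a perfect matching on the complement,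
    described inside a given vertex set. *)
Definition matching_join A : Prop :=
  [/\ forall x y, x \in A -> y \notin A -> g x y,
      forall x, x \in A -> inner_degree A x = 1 &
      forall x, x \notin A -> inner_degree (~: A) x = 1].

Lemma cross_weightC A : cross_weight (~: A) = cross_weight A.
Proof.
rewrite /cross_weight setCK exchange_big; apply: eq_bigr => x _; apply: eq_bigr => y _.
by rewrite g_sym codegC.
Qed.

(** A triangle not contained in a part has exactly two of its three edges
    crossing. *)
Lemma ordered_triangles_cross A : no_inner_triangle A ->
  ordered_triangles g = 3 * cross_weight A.
Proof.
move=> noT; pose f x y := (x \in A) != (y \in A) : nat.
have crossE : \sum_x \sum_y g x y * (codeg g x y * f x y) = 2 * cross_weight A.
  have half B : \sum_(x in B) \sum_y g x y * (codeg g x y * ((x \in B) != (y \in B))) =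
      cross_weight B.
    apply: eq_bigr => x xB; rewrite [RHS]big_mkcond; apply: eq_bigr => y _ /=.
    by rewrite inE xB; case: (y \in B); rewrite /= ?muln0 ?muln1.
  rewrite (bigID (mem A)) /= half mulSn mul1n; congr (_ + _).
  rewrite -cross_weightC -half; apply: eq_big => [x|x _]; first by rewrite inE.
  by apply: eq_bigr => y _; rewrite /f !inE; case: (x \in A); case: (y \in A).
suff : 2 * ordered_triangles g = 3 * \sum_x \sum_y g x y * (codeg g x y * f x y) by lia.
rewrite -(sum3_triangle_edges g_sym) -sum3Ml; apply: eq_sum3 => x y z.
case t: (triangle g x y z); rewrite /= ?muln0 // !mul1n /f.
move: (noT x y z t); case: (x \in A); case: (y \in A); case: (z \in A) => // h;
  by case: h.
Qed.

(** Used for x in A and y outside A: a common neighbour in A is counted at x, one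
    outside A at y. *)
Lemma leq_codeg_inner A x y :
  codeg g x y <= inner_degree A x + inner_degree (~: A) y.
Proof.
rewrite /codeg /inner_degree -sum1_card (bigID (mem A)) /=; apply: leq_add.
  rewrite [X in X <= _]big_mkcond [X in _ <= X]big_mkcond /=; apply: leq_sum => z _.
  by rewrite inE; case: (z \in A); case: (g x z); case: (g y z).
rewrite [X in X <= _]big_mkcond [X in _ <= X]big_mkcond /=; apply: leq_sum => z _.
by rewrite !inE; case: (z \in A); case: (g x z); case: (g y z).
Qed.

Lemma same_side_neighbour_unique A x y z : matching_join A ->
  g x y -> g x z -> (y \in A) = (x \in A) -> (z \in A) = (x \in A) -> y = z.
Proof.
case=> _ dA dB gxy gxz yA zA; apply/eqP/negPn/negP => yz.
have aux (B : {set V}) : y \in B -> z \in B -> inner_degree B x = 1 -> False.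
  move=> yB zB; rewrite /inner_degree (bigD1 y) //= (bigD1 z) /=.
    by rewrite gxy gxz; lia.
  by rewrite zB eq_sym.
case: (boolP (x \in A)) => xA; rewrite ?xA ?(negPf xA) in yA zA.
  by apply: (aux A) => //; exact: dA.
by apply: (aux (~: A)); rewrite ?inE ?yA ?zA // dB.
Qed.

Lemma matching_join_no_inner_triangle A : matching_join A -> no_inner_triangle A.
Proof.
move=> mA x y z /and3P[gxy gyz gxz] xyA yzA.
have yz := same_side_neighbour_unique mA gxy gxz (esym xyA) (esym (etrans xyA yzA)).
by rewrite yz g_irr in gyz.
Qed.

Lemma cross_weight_matching_join A : matching_join A ->
  cross_weight A = 2 * (#|A| * #|~: A|).
Proof.
case=> cross dA dB; rewrite /cross_weight.
have inner x y : x \in A -> y \in ~: A -> g x y * codeg g x y = 2.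
  move=> xA yB; have yA : y \notin A by move: yB; rewrite inE.
  rewrite cross // mul1n -[2]/(1 + 1) -{1}(dA x xA) -(dB y yA).
  rewrite /codeg -sum1_card (bigID (mem A)) /=; congr (_ + _).
    rewrite [LHS]big_mkcond [RHS]big_mkcond /=; apply: eq_bigr => z _.
    rewrite inE; case zA: (z \in A); rewrite ?andbF // (g_sym y) (cross z y) // andbT.
    by case: (g x z).
  rewrite [LHS]big_mkcond [RHS]big_mkcond /=; apply: eq_bigr => z _.
  rewrite !inE; case zA: (z \in A); rewrite ?andbF //= (cross x z) ?zA //=.
  by case: (g y z).
under eq_bigr => x xA do (under eq_bigr => y yB do rewrite inner //).
by rewrite !sum_nat_const; lia.
Qed.

(** If no two vertices of inner degree at least two are adjacent, every edge has an
    endpoint of degree one.  With H the set of vertices of larger degree, the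
    edges at H are counted by the leaves, and H is not empty. *)
Lemma star_forest_size A x : (forall u v, u \in A -> v \in A -> g u v ->
    1 < inner_degree A u -> inner_degree A v <= 1) ->
  x \in A -> 1 < inner_degree A x ->
  \sum_(u in A) inner_degree A u <= 2 * (#|A| - 1).
Proof.
move=> leaf xA x2; pose H := [set u in A | 1 < inner_degree A u].
have sHA : H \subset A by apply/subsetP => u; rewrite inE => /andP[].
have xH : x \in H by rewrite inE xA x2.
have := arcs_split g_sym sHA; rewrite -[arcs g A A]/(\sum_(u in A) inner_degree A u).
have -> : arcs g H H = 0.
  apply: arcs_eq0 => u v; rewrite !inE => /andP[uA u2] /andP[vA v2].
  by apply/negP => guv; have := leaf u v uA vA guv u2; rewrite leqNgt v2.
have : arcs g (A :\: H) A <= #|A :\: H|.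
  rewrite -sum1_card; apply: leq_sum => u; rewrite !inE => /andP[+ uA].
  by rewrite uA /= -leqNgt.
rewrite (arcsDr _ _ sHA).
have := cardsID H A; rewrite (setIidPr sHA); have := cardsD1 x H; rewrite xH.
lia.
Qed.
End Bipartition.

(** * Sun-free graphs with many triangles *)

Section Structure.
Variables (V : finType) (g : rel V).
Hypotheses (g_sym : symmetric g) (g_irr : irreflexive g) (g_sun_free : sun_free g).
Implicit Types (A B S : {set V}) (x y z : V).

Definition light_bipartition A : Prop :=
  forall x y, light g x y -> (x \in A) = (y \notin A).

(** Stated without counting, as a missing pair is exploited: any two missing pairs
    coincide. *)
Definition misses_at_most_one A : Prop := forall u1 u2 v1 v2,
  u1 \in A -> u2 \in A -> v1 \notin A -> v2 \notin A ->
  ~~ g u1 v1 -> ~~ g u2 v2 -> u1 = u2 /\ v1 = v2.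

Lemma light_bipartitionC A : light_bipartition A -> light_bipartition (~: A).
Proof. by move=> h x y /h; rewrite !inE => ->. Qed.

Lemma misses_at_most_oneC A : misses_at_most_one A -> misses_at_most_one (~: A).
Proof.
move=> h u1 u2 v1 v2; rewrite !inE !negbK => u1A u2A v1A v2A g1 g2.
by have [] := h v1 v2 u1 u2 v1A v2A u1A u2A; rewrite 1?g_sym.
Qed.

Lemma arcs_neg A B : arcs g A B + arcs (fun x y => ~~ g x y) A B = #|A| * #|B|.
Proof.
rewrite /arcs -big_split -sum_nat_const; apply: eq_bigr => x _ /=.
rewrite -big_split -sum1_card; apply: eq_bigr => y _ /=.
by case: (g x y).
Qed.

Lemma arcs_misses_at_most_one A : #|A| * #|~: A| <= (arcs g A (~: A)).+1 -> misses_at_most_one A.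
Proof.
rewrite -arcs_neg -addn1 leq_add2l /arcs pair_big /= => le1 u1 u2 v1 v2 u1A u2A v1A v2A g1 g2.
have : #|[set p : V * V | [&& p.1 \in A, p.2 \notin A & ~~ g p.1 p.2]]| <= 1.
  apply: leq_trans le1; rewrite -sum1_card big_mkcond [X in _ <= X]big_mkcond /=.
  apply: leq_sum => -[x y] _; rewrite !inE /=.
  by case: (x \in A); case: (y \in A); case: (g x y).
move/card_le1_eqP/(_ (u1, v1) (u2, v2)); rewrite !inE /= u1A u2A v1A v2A g1 g2.
by case/(_ isT isT).
Qed.

Section OneSide.
Variable A : {set V}.
Hypotheses (A_light : light_bipartition A) (A_miss : misses_at_most_one A).

(** All light edges cross, so an edge inside a part has codegree at least 4. *)
Lemma inner_edge_heavy x y : g x y -> (x \in A) = (y \in A) -> 3 < codeg g x y.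
Proof.
move=> gxy xyA; rewrite ltnNge; apply/negP => c3.
by have := A_light (x := x) (y := y); rewrite /light gxy c3 xyA => /(_ isT); case: (y \in A).
Qed.

(** Its three edges would all be heavy, hence of total weight zero. *)
Lemma light_bipartition_no_inner_triangle : no_inner_triangle g A.
Proof.
move=> x y z t xyA yzA; have := weight_triangle g_sym g_irr g_sun_free t.
case/and3P: t => gxy gyz gxz.
have w0 u v : g u v -> (u \in A) = (v \in A) -> weight (codeg g u v) = 0.
  by move=> guv uvA; rewrite /weight leqNgt inner_edge_heavy.
by rewrite !w0 // xyA.
Qed.

(** On the triangle x x' y the edge x x' is heavy, so by [no_sdr_large] the vertices
    completing its two other edges coincide.  One of them is x''; were q another
    common neighbour of x' and y, it would equal x'', and x x' x'' would be a
    triangle inside A. *)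
Lemma fork_conbr x x' x'' y q : x \in A -> x' \in A -> x'' \in A -> x' != x'' ->
    g x x' -> g x x'' -> y \notin A -> g x y -> g x' y -> g x'' y ->
  g x' q -> g y q -> q = x.
Proof.
move=> xA x'A x''A x'x'' gxx' gxx'' yA gxy gx'y gx''y gx'q gyq.
apply/eqP/negPn/negP => qx.
have t : triangle g x x' y by rewrite /triangle gxx' gx'y gxy.
have ns := no_sdr_rot (no_sdr_rot (triangle_no_sdr g_irr g_sun_free t)).
have big : 2 < #|conbr g x x' :\ y|.
  by rewrite -ltnS -codeg_triangle // inner_edge_heavy // xA x'A.
have eq_q : q = x''.
  apply: (no_sdr_large ns big); first by rewrite !inE qx gx'q.
  by rewrite !inE eq_sym x'x'' gxx'' g_sym.
apply: (@light_bipartition_no_inner_triangle x x' x''); rewrite ?xA ?x'A //.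
by rewrite /triangle gxx' gxx'' -eq_q gx'q.
Qed.

(** If y y' is an edge outside A, one of y, y', say y, misses none of x, x', x'';
    then y' is adjacent to x' or x'' and contradicts [fork_conbr]. *)
Lemma fork_no_edge_across x x' x'' : x \in A -> x' \in A -> x'' \in A -> x' != x'' ->
    g x x' -> g x x'' ->
  forall y y', y \notin A -> y' \notin A -> ~~ g y y'.
Proof.
move=> xA x'A x''A x'x'' gxx' gxx'' y y' yA y'A; apply/negP => gyy'.
wlog full : y y' yA y'A gyy' / [&& g x y, g x' y & g x'' y].
  move=> wl; have [|nfull] := boolP [&& g x y, g x' y & g x'' y]; first exact: (wl y y').
  apply: (wl y' y) => //; first by rewrite g_sym.
  have [u uA nu] : exists2 u, u \in A & ~~ g u y.
    by move: nfull; rewrite !negb_and => /or3P[] ?; [exists x|exists x'|exists x''].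
  have aux v : v \in A -> g v y'.
    move=> vA; apply/negPn/negP => nv.
    by have [_ yy'] := A_miss uA vA yA y'A nu nv; rewrite yy' g_irr in gyy'.
  by rewrite !aux.
case/and3P: full => gxy gx'y gx''y.
have y'x : y' != x by apply: contraNneq y'A => ->.
have n' : ~~ g x' y'.
  by apply: contraNN y'x => gx'y'; apply/eqP; apply: (@fork_conbr x x' x'' y).
have n'' : ~~ g x'' y'.
  apply: contraNN y'x => gx''y'; apply/eqP; apply: (@fork_conbr x x'' x' y) => //.
  by rewrite eq_sym.
by have [/eqP] := A_miss x'A x''A y'A y'A n' n''; rewrite (negPf x'x'').
Qed.

(** Only one of two vertices outside A can be on the missing pair. *)
Lemma full_vertex : 1 < #|~: A| -> exists2 y, y \notin A & forall x, x \in A -> g x y.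
Proof.
case/card_gt1P=> y [y' [yA y'A yy']]; rewrite !inE in yA y'A.
have [/exists_inP[u uA nu]|full] := boolP [exists u in A, ~~ g u y]; last first.
  by exists y => // x xA; apply: contraR full => nx; apply/exists_inP; exists x.
exists y' => // x xA; apply/negPn/negP => nx.
by have [_ /eqP] := A_miss uA xA yA y'A nu nx; rewrite (negPf yy').
Qed.

Lemma inner_degree_gt1 x : 1 < inner_degree g A x ->
  exists x' x'', [/\ x' \in A, x'' \in A, x' != x'', g x x' & g x x''].
Proof.
rewrite /inner_degree sum_row_card => /card_gt1P[x' [x'' [+ + ne]]].
by rewrite !inE => /andP[? ?] /andP[? ?]; exists x', x''.
Qed.

(** A vertex with two neighbours in A would make the other part independent
    and, by [fork_conbr] at a full vertex, A a star forest.  Triangles would then be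
    at most |B| (|A| - 1), which is |B| > 1 short of |A| |B|. *)
Lemma inner_degree_le1 : 1 < #|~: A| ->
    2 * (#|A| * #|~: A|) <= cross_weight g A + 2 ->
  forall x, x \in A -> inner_degree g A x <= 1.
Proof.
move=> B2 heavy x xA; rewrite leqNgt; apply/negP => x2.
have noB y y' : y \notin A -> y' \notin A -> ~~ g y y'.
  have [x' [x'' [x'A x''A ne gx' gx'']]] := inner_degree_gt1 x2.
  exact: fork_no_edge_across ne gx' gx'' y y'.
have leaf u v : u \in A -> v \in A -> g u v -> 1 < inner_degree g A u ->
    inner_degree g A v <= 1.
  move=> uA vA guv /inner_degree_gt1[u' [u'' [u'A u''A ne gu' gu'']]].
  have [w [wA vw guw]] : exists w, [/\ w \in A, v != w & g u w].
    by have [vu'|?] := eqVneq v u'; [exists u''; rewrite vu'|exists u'].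
  rewrite /inner_degree (bigD1 u) //= g_sym guv big1 // => q /andP[qA qu].
  apply/eqP; rewrite eqb0; apply: contraNN qu => gvq; apply/eqP.
  have [y yA full] := full_vertex B2.
  by apply: (@fork_conbr u v w y q); rewrite // ?full // g_sym full.
have forest := star_forest_size g_sym leaf xA x2.
have : cross_weight g A <= \sum_(u in A) #|~: A| * inner_degree g A u.
  apply: leq_sum => u uA; rewrite -sum_nat_const; apply: leq_sum => y.
  rewrite inE => yA; have := leq_codeg_inner g A u y.
  have -> : inner_degree g (~: A) y = 0.
    by rewrite /inner_degree big1 // => z; rewrite inE => zA; rewrite (negPf (noB _ _ yA zA)).
  by case: (g u y); rewrite ?mul1n ?addn0.
rewrite -big_distrr /=.
have A1 : 0 < #|A| by apply/card_gt0P; exists x.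
have := leq_mul (leqnn #|~: A|) forest; move: heavy B2 A1; clear.
move: (cross_weight g A) => s; move: (\sum_(u in A) _) => t.
case: #|A| => // a; rewrite subn1 /=; move: #|~: A| => b; nia.
Qed.
End OneSide.

(** The codegree of a cross edge is at most 2, so the total defect D from the value
    2 on all pairs is at most 2.  An unmatched vertex would cost 1 on every pair it
    belongs to, hence at least 3.  A missing pair uv would cost 2 there and 1 more
    on the pair formed by v and the partner of u. *)
Lemma matching_join_of_cross_weight A :
    light_bipartition A -> misses_at_most_one A -> 2 < #|A| -> 2 < #|~: A| ->
    2 * (#|A| * #|~: A|) <= cross_weight g A + 2 ->
  matching_join g A.
Proof.
move=> Al Am A3 B3 heavy.
have dA x : x \in A -> inner_degree g A x <= 1.
  by apply: inner_degree_le1 => //; apply: ltnW.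
have dB y : y \notin A -> inner_degree g (~: A) y <= 1.
  move=> yA; apply: inner_degree_le1; rewrite ?setCK ?inE //.
  - exact: light_bipartitionC.
  - exact: misses_at_most_oneC.
  - exact: ltnW.
  - by rewrite cross_weightC // mulnC [#|~: A| * _]mulnC mulnC.
pose F x y := g x y * codeg g x y; pose D x y := 2 - F x y.
have F2 x y : x \in A -> y \in ~: A -> F x y <= 2.
  rewrite inE /F => xA yA; have := leq_codeg_inner g A x y.
  by have := dA x xA; have := dB y yA; case: (g x y) => /=; lia.
have D2 : \sum_(x in A) \sum_(y in ~: A) D x y <= 2.
  have : \sum_(x in A) \sum_(y in ~: A) (F x y + D x y) = #|A| * (#|~: A| * 2).
    rewrite -sum_nat_const; apply: eq_bigr => x xA; rewrite -sum_nat_const.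
    by apply: eq_bigr => y yB; rewrite /D subnKC ?F2.
  under eq_bigr do rewrite big_split /=; rewrite big_split /=.
  rewrite -[\sum_(x in A) \sum_(y in ~: A) F x y]/(cross_weight g A); lia.
have F1 x y : F x y <= inner_degree g A x + inner_degree g (~: A) y.
  by apply: leq_trans (leq_codeg_inner g A x y); rewrite /F; case: (g x y); rewrite ?mul1n.
have row x : x \in A -> \sum_(y in ~: A) D x y <= 2.
  by move=> xA; apply: leq_trans D2; rewrite [X in _ <= X](bigD1 x) //= leq_addr.
have deg1A x : x \in A -> inner_degree g A x = 1.
  move=> xA; have := dA x xA; case dx: (inner_degree g A x) => [|[|]] // _.
  suff le : #|~: A| <= \sum_(y in ~: A) D x y by have := leq_trans B3 (leq_trans le (row x xA)).
  rewrite -sum1_card; apply: leq_sum => y; rewrite inE => yA.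
  by rewrite /D; have := F1 x y; rewrite dx; have := dB y yA; lia.
have col y : y \in ~: A -> \sum_(x in A) D x y <= 2.
  by move=> yB; apply: leq_trans D2; rewrite exchange_big [X in _ <= X](bigD1 y) //= leq_addr.
have deg1B y : y \notin A -> inner_degree g (~: A) y = 1.
  move=> yA; have := dB y yA; case dy: (inner_degree g (~: A) y) => [|[|]] // _.
  have yB : y \in ~: A by rewrite inE.
  suff le : #|A| <= \sum_(x in A) D x y by have := leq_trans A3 (leq_trans le (col y yB)).
  rewrite -sum1_card; apply: leq_sum => x xA.
  by rewrite /D; have := F1 x y; rewrite dy; have := dA x xA; lia.
split=> // u v uA vA; apply/negPn/negP => nuv.
(* the partner of u loses a common neighbour with v as well *)
have [u' u'A guu'] : exists2 u', u' \in A & g u u'.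
  have : 0 < inner_degree g A u by rewrite deg1A.
  rewrite /inner_degree sum_row_card => /card_gt0P[u']; rewrite inE => /andP[? ?].
  by exists u'.
have vB : v \in ~: A by rewrite inE.
have u'u : u' != u by rewrite eq_sym (edge_neq g_irr).
have := col v vB; rewrite (bigD1 u) //= (bigD1 u') /=; last by rewrite u'A.
have -> : D u v = 2 by rewrite /D /F (negPf nuv).
suff : F u' v <= 1 by rewrite /D; lia.
apply: (@leq_trans (codeg g u' v)); first by rewrite /F; case: (g u' v); rewrite ?mul1n.
rewrite -(deg1B v vA) /inner_degree sum_row_card; apply: subset_leq_card.
apply/subsetP => z; rewrite !inE => /andP[gu'z gvz]; rewrite gvz andbT.
apply/negP => zA; have zu : z != u by apply: contraNneq nuv => <-; rewrite g_sym.
have := deg1A u' u'A; rewrite /inner_degree (bigD1 u) //= (bigD1 z) /=; last by rewrite zA.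
by rewrite g_sym guu' gu'z; lia.
Qed.

(** The hypothesis says that the number t of triangles is at least n^2 / 4 - 1, as
    there are 6t ordered triangles. *)
Lemma many_triangles_matching_join : 22 <= #|V| ->
    3 * #|V| ^ 2 <= 2 * ordered_triangles g + 12 ->
  exists A, matching_join g A.
Proof.
move=> n22 many.
have large : #|V| ^ 2 <= 2 * arcs (light g) setT setT + 4.
  have := ordered_triangles_light g_sym g_irr g_sun_free; lia.
have tf := light_triangle_free g_sym g_irr g_sun_free n22 large.
have n7 : 7 <= #|V| by apply: leq_trans n22.
have [A Al] := mantel_stability (light_sym g_sym) n7 tf large.
have cardAB : #|A| + #|~: A| = #|V| by rewrite cardsC.
have [agm _] := nat_AGM2 #|A| #|~: A|; rewrite cardAB in agm.
have lightE : arcs (light g) setT setT = 2 * arcs (light g) A (~: A).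
  rewrite (arcs_split (light_sym g_sym) (subsetT A)) setTD (arcsC (light_sym g_sym) (~: A)).
  have ind B : (B = A \/ B = ~: A) -> arcs (light g) B B = 0.
    move=> eB; apply: arcs_eq0 => x y xB yB; apply/negP => /Al.
    by move: xB yB; case: eB => ->; rewrite ?inE; case: (x \in A); case: (y \in A).
  by rewrite (ind A) ?(ind (~: A)) ?addn0; [|right|left].
have le_arcs : arcs (light g) A (~: A) <= arcs g A (~: A).
  by apply: leq_sum => x _; apply: leq_sum => y _; rewrite /light; case: (g x y); rewrite ?leq_b1.
have le_ab := leq_arcs (light g) A (~: A).
have Am : misses_at_most_one A by apply: arcs_misses_at_most_one; lia.
have [A3 B3] : 2 < #|A| /\ 2 < #|~: A|.
  have : #|V| ^ 2 <= 4 * (#|A| * #|~: A|) + 4 by lia.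
  rewrite -cardAB; move: cardAB n22; move: #|A| #|~: A| #|V|; clear.
  move=> a b n <- n22 h; split; rewrite ltnNge; apply/negP; nia.
exists A; apply: matching_join_of_cross_weight => //.
have := ordered_triangles_cross g_sym (light_bipartition_no_inner_triangle Al); lia.
Qed.
End Structure.

(** * Joins of two perfect matchings *)

Section MatchingJoins.
Variables (V : finType) (g : rel V).
Hypotheses (g_sym : symmetric g) (g_irr : irreflexive g).
Implicit Types (A B S : {set V}) (x y z : V).

(** Every triangle consists of a matching edge and a vertex of the other side.  Two of
    the outer vertices of a sun would thus be the partner of the same vertex. *)
Lemma matching_join_sun_free A : matching_join g A -> sun_free g.
Proof.
move=> mA x y z x' y' z' un gxy gyz gxz X Y Z.
have noT := matching_join_no_inner_triangle g_irr mA.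
have uniqn := same_side_neighbour_unique mA.
(* on a triangle with x, y on one side, the vertices completing the edges at z
   both have to be the partner of z *)
have aux u v w u' v' : g u v -> (u \in A) = (v \in A) -> (w \in A) != (u \in A) ->
    u' \in conbr g v w -> v' \in conbr g u w -> u' != u -> v' != v -> u' = v'.
  move=> guv uvA wA; rewrite !inE => /andP[gvu' gwu'] /andP[guv' gwv'] u'u v'v.
  apply: (uniqn w) => //.
    apply: contraNeq u'u => u'A; apply/eqP/(uniqn v); rewrite // 1?g_sym //.
    by move: u'A wA; rewrite -uvA; case: (u' \in A); case: (w \in A); case: (u \in A).
  apply: contraNeq v'v => v'A; apply/eqP/(uniqn u) => //.
  by move: v'A wA; case: (v' \in A); case: (w \in A); case: (u \in A).
move: un; rewrite /= !inE !negb_or !andbT.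
case/and5P=> /and5P[_ _ xx' xy' xz'] /and4P[_ yx' yy' yz'] /and3P[zx' zy' zz'].
case/andP=> x'y' x'z' y'z'.
case: (eqVneq (x \in A) (y \in A)) => xyA.
  case: (eqVneq (z \in A) (x \in A)) => zA.
    by apply: (noT x y z); rewrite /triangle ?gxy ?gyz ?gxz // zA.
  by case/eqP: x'y'; apply: (aux x y z); rewrite // eq_sym.
case: (eqVneq (x \in A) (z \in A)) => xzA.
  case/eqP: x'z'; apply: (aux x z y); rewrite 1?(conbrC _ z) // eq_sym //.
case/eqP: y'z'; apply: (aux y z x); rewrite 1?(conbrC _ _ x) // 1?eq_sym //.
by move: xyA xzA; case: (x \in A); case: (y \in A); case: (z \in A).
Qed.

Lemma perfect_matching_mate A : (forall x, x \in A -> inner_degree g A x = 1) ->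
  exists m : V -> V, forall x, x \in A -> m x \in A /\ forall y, y \in A -> g x y = (y == m x).
Proof.
move=> dA; exists (fun x => odflt x [pick y | (y \in A) && g x y]) => x xA.
have := dA x xA; rewrite /inner_degree => d1.
case: pickP => [y /andP[yA gxy]|none] /=; last first.
  by move: d1; rewrite big1 // => y yA; have := none y; rewrite yA => /= ->.
split=> // z zA; apply/idP/eqP => [gxz|->] //; apply/eqP/negPn/negP => zy.
move: d1; rewrite (bigD1 y) //= (bigD1 z) /= ?zA // gxy gxz; lia.
Qed.

(** Identifies a perfect matching with [matching_graph p]: a vertex is given by the
    number of its edge and by which of the two endpoints it is. *)
Lemma perfect_matching_coordinates A : A != set0 ->
    (forall x, x \in A -> inner_degree g A x = 1) ->
  exists p, #|A| = p.*2 /\ exists f : V -> 'I_p * bool,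
    {in A &, injective f} /\
    {in A &, forall x y, g x y = (x != y) && ((f x).1 == (f y).1)}.
Proof.
move=> A0 /perfect_matching_mate[m mP].
have mA x : x \in A -> m x \in A by case/mP.
have mE x y : x \in A -> y \in A -> g x y = (y == m x) by case/mP => _ /[apply].
have mK x : x \in A -> m (m x) = x.
  by move=> xA; apply/esym/eqP; rewrite -mE ?mA // g_sym mE ?mA.
have mx x : x \in A -> m x != x.
  by move=> xA; apply/eqP => e; have := g_irr x; rewrite mE // e eqxx.
(* each edge of the matching is represented by its endpoint of smaller rank *)
pose R := [set x in A | enum_rank x < enum_rank (m x)].
have RP x : x \in A -> (m x \in R) = (x \notin R).
  move=> xA; rewrite !inE mA // xA mK //= -leqNgt [RHS]leq_eqVlt.
  by rewrite (inj_eq (@ord_inj _)) (inj_eq enum_rank_inj) (negPf (mx x xA)).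
have cardA : #|A| = #|R|.*2.
  have sRA : R \subset A by apply/subsetP => x; rewrite inE => /andP[].
  rewrite -(cardsID R A) (setIidPr sRA) -addnn; congr (_ + _).
  have inj : {in A &, injective m}.
    by move=> x y xA yA e; rewrite -(mK x xA) e mK.
  rewrite -(card_in_imset (f := m) (D := R)); last by apply: sub_in2 inj; apply/subsetP.
  apply: eq_card => x; apply/setDP/imsetP => [[xA xR]|[y yR ->]].
    by exists (m x); rewrite ?RP ?mK.
  by have yA := subsetP sRA y yR; rewrite mA // RP // yR.
exists #|R|; split=> //.
have R0 : 0 < #|R|.
  by have := A0; rewrite -card_gt0 cardA; case: #|R|.
pose rep x := if x \in R then x else m x.
have repR x : x \in A -> rep x \in R.
  by move=> xA; rewrite /rep; case: ifPn => // xR; rewrite RP.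
pose f x : 'I_#|R| * bool := (insubd (Ordinal R0) (index (rep x) (enum R)), x \in R).
have fE x y : x \in A -> y \in A -> ((f x).1 == (f y).1) = (rep x == rep y).
  move=> xA yA; rewrite -(inj_eq val_inj) /= !val_insubd.
  have idx u : u \in A -> index (rep u) (enum R) < #|R|.
    by move=> uA; rewrite cardE index_mem mem_enum repR.
  rewrite !idx //; apply/eqP/eqP => [e|-> //].
  rewrite -(nth_index x (s := enum R) (x := rep x)) ?mem_enum ?repR // e.
  by rewrite nth_index ?mem_enum ?repR.
have rep_eq x y : x \in A -> y \in A -> (rep x == rep y) = (x == y) || (y == m x).
  move=> xA yA; rewrite /rep.
  case: ifPn => xR; case: ifPn => yR.
  - have [|//] := eqVneq x y; first by [].
    by move=> _ /=; apply/esym/negbTE; apply: contraTneq yR => ->; rewrite RP // xR.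
  - have -> : (x == y) = false by apply: contraNF yR => /eqP <-.
    by apply/eqP/eqP => [->|->]; rewrite mK.
  - have -> : (x == y) = false by apply: contraNF xR => /eqP ->.
    by rewrite eq_sym.
  - have -> : (y == m x) = false by apply: contraNF yR => /eqP ->; rewrite RP.
    by rewrite orbF; apply/eqP/eqP => [e|-> //]; rewrite -(mK x xA) e mK.
exists f; split=> x y xA yA.
  move=> fxy; have /eqP : (f x).1 = (f y).1 by rewrite fxy.
  rewrite fE // rep_eq // => /orP[/eqP //|/eqP yE].
  by have : (f x).2 = (f y).2 by [rewrite fxy]; rewrite /= yE RP //; case: (x \in R).
rewrite fE // rep_eq // mE //; have [->|] //= := eqVneq x y.
by rewrite eq_sym (negPf (mx y yA)).
Qed.
End MatchingJoins.

(** * Copies of a graph, cliques and triangles *)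

Section Copies.
Variables (W V : finType) (H : sgraph W) (G : sgraph V).

Lemma edges_pair (U : finType) (K : sgraph U) (e : {set U}) : e \in edges K ->
  exists x y, [/\ x != y, e = [set x; y] & adj K x y].
Proof.
move=> eK; have /forall_inP/(_ e eK)/cards2P[x [y [xy eE]]] := edges_card2 K.
by exists x, y; rewrite /adj -eE.
Qed.

Lemma adj_sym (U : finType) (K : sgraph U) : symmetric (adj K).
Proof. by move=> x y; rewrite /adj setUC. Qed.

Lemma adj_irr (U : finType) (K : sgraph U) : irreflexive (adj K).
Proof.
move=> x; apply/negP => xx; have /forall_inP/(_ _ xx) := edges_card2 K.
by rewrite setUid cards1.
Qed.

Lemma imset_pair (U T : finType) (f : U -> T) x y : f @: [set x; y] = [set f x; f y].
Proof. by rewrite imsetU1 imset_set1. Qed.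

(** Copies are images of injective homomorphisms. *)
Lemma is_freeP : reflect
  (forall f : W -> V, injective f -> ~ (forall x y, adj H x y -> adj G (f x) (f y)))
  (is_free H G).
Proof.
apply: (iffP eqP) => [free f inj_f hom_f|free].
  pose S := (f @: [set: W], [set f @: (e : {set W}) | e in edges H]).
  suff : S \in copies H G by rewrite free inE.
  rewrite inE; apply/andP; split.
    apply/subsetP => _ /imsetP[e /edges_pair[x [y [_ -> xy]]] ->].
    by rewrite imset_pair; exact: hom_f.
  apply/existsP; exists (finfun f); apply/and3P; split.
  - by apply/injectiveP => x y; rewrite !ffunE => /inj_f.
  - by apply/eqP/eq_imset => x; rewrite ffunE.
  - by apply/eqP/eq_imset => e; apply: eq_imset => x; rewrite ffunE.
apply/setP => S; rewrite [RHS]inE; apply/negP; rewrite inE.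
case/andP=> sub /existsP[f /and3P[/injectiveP inj_f _ /eqP SE]].
case: (free f inj_f) => x y xy; apply: (subsetP sub); rewrite SE -imset_pair.
exact: imset_f.
Qed.
End Copies.

Section Cliques.
Variables (V : finType) (G : sgraph V).
Implicit Types (P : {set V}) (x y z : V).

Definition pairs_of (U : finType) (P : {set U}) : {set {set U}} :=
  [set e : {set U} | (#|e| == 2) && (e \subset P)].

Lemma edges_complete_graph r : edges (complete_graph r) = pairs_of setT.
Proof.
apply/setP => e; rewrite [RHS]inE subsetT andbT.
apply/idP/cards2P => [/edges_pair[x [y [xy -> _]]]|[x [y [xy ->]]]]; first by exists x, y.
by rewrite -[_ \in _]/(adj (complete_graph r) x y) adj_graph_of xy.
Qed.

Lemma imset_pairs_of (U T : finType) (f : U -> T) : injective f ->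
  [set f @: (e : {set U}) | e in pairs_of setT] = pairs_of (f @: setT).
Proof.
move=> inj_f; apply/setP => e; apply/imsetP/idP => [[e' + ->]|].
  by rewrite !inE subsetT card_imset // => /andP[-> _]; rewrite imsetS ?subsetT.
rewrite inE => /andP[/cards2P[x [y [xy ->]]]]; rewrite subUset !sub1set.
case/andP=> /imsetP[a _ xE] /imsetP[b _ yE]; exists [set a; b].
  rewrite inE subsetT andbT cards2; suff -> : a != b by [].
  by apply: contraNneq xy => ab; rewrite xE yE ab.
by rewrite imset_pair -xE -yE.
Qed.

Definition cliques r : {set {set V}} :=
  [set P : {set V} | (#|P| == r) && (pairs_of P \subset edges G)].

(** A copy of a complete graph is determined by its vertex set. *)
Lemma card_copies_complete_graph r : #|copies (complete_graph r) G| = #|cliques r|.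
Proof.
have -> : copies (complete_graph r) G = [set (P, pairs_of P) | P in cliques r].
  apply/setP => S; apply/idP/imsetP => [|[P + ->]]; rewrite !inE edges_complete_graph.
    case/andP=> sub /existsP[f /and3P[/injectiveP inj_f /eqP S1 /eqP S2]].
    rewrite imset_pairs_of // -S1 in S2; exists S.1; last by rewrite -S2; case: (S).
    by rewrite inE -S2 sub andbT S1 card_imset // cardsT card_ord.
  case/andP=> /eqP cardP sub; rewrite sub /=.
  pose f (i : 'I_r) : V := enum_val (cast_ord (esym cardP) i).
  have inj_f : injective f by move=> i j /enum_val_inj /cast_ord_inj.
  have fP : f @: setT = P.
    apply/eqP; rewrite eqEcard card_imset // cardsT card_ord cardP leqnn andbT.
    by apply/subsetP => _ /imsetP[i _ ->]; exact: enum_valP.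
  apply/existsP; exists (finfun f); apply/and3P; split.
  - by apply/injectiveP => x y; rewrite !ffunE => /inj_f.
  - by rewrite -fP; apply/eqP/eq_imset => x; rewrite ffunE.
  - rewrite -fP -imset_pairs_of //.
    by apply/eqP/eq_imset => e; apply: eq_imset => x; rewrite ffunE.
by rewrite card_in_imset // => P Q _ _ [].
Qed.

Lemma pairs_of_triple x y z : x != y -> y != z -> x != z ->
  (pairs_of [set x; y; z] \subset edges G) = triangle (adj G) x y z.
Proof.
move=> xy yz xz; apply/subsetP/and3P => [sub|[axy ayz axz] e].
  by split; apply: sub; rewrite inE cards2 ?xy ?yz ?xz /= subUset !sub1set !inE !eqxx ?orbT.
rewrite inE => /andP[/cards2P[a [b [ab ->]]]]; rewrite subUset !sub1set !inE.
case/andP=> /orP[/orP[]|] /eqP ea /orP[/orP[]|] /eqP eb; subst a b;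
  rewrite ?eqxx // in ab *; by rewrite // setUC.
Qed.

Lemma triple_fiber x y z : x != y -> y != z -> x != z ->
  #|[set p : V * V * V | [set p.1.1; p.1.2; p.2] == [set x; y; z]]| = 6.
Proof.
move=> xy yz xz.
have c3 : #|[set x; y; z]| = 3.
  by rewrite -setUA cardsU1 cards2 !inE negb_or xy yz xz.
pose s := [:: (x, y, z); (x, z, y); (y, x, z); (y, z, x); (z, x, y); (z, y, x)].
have us : uniq s.
  rewrite /= !inE !xpair_eqE !eqxx [z == x]eq_sym [z == y]eq_sym [y == x]eq_sym.
  by rewrite (negPf xy) (negPf yz) (negPf xz) ?andbF.
rewrite -[6]/(size s) -(card_uniqP us).
apply: eq_card => -[[a b] c]; rewrite inE /=.
apply/eqP/idP => [E|].
  have abc : (a != b) && (b != c) && (a != c).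
    have := c3; rewrite -E -setUA cardsU1 cards2 !inE.
    by case: (a == b); case: (b == c); case: (a == c).
  have : [&& a \in [set x; y; z], b \in [set x; y; z] & c \in [set x; y; z]].
    by rewrite -E !inE !eqxx ?orbT.
  rewrite !inE -!orbA => /and3P[/or3P[]/eqP aE /or3P[]/eqP bE /or3P[]/eqP cE];
    move: abc; rewrite aE bE cE ?eqxx /= ?andbF // => _;
    by rewrite /s ?inE !xpair_eqE !eqxx ?orbT.
by rewrite /s !inE => /or4P[| | |/or3P[]] /eqP[-> -> ->]; apply/setP => u;
  rewrite !inE; case: (u == x); case: (u == y); case: (u == z).
Qed.

Lemma ordered_triangles_copies :
  ordered_triangles (adj G) = 6 * #|copies (complete_graph 3) G|.
Proof.
pose tr (p : V * V * V) := [set p.1.1; p.1.2; p.2].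
pose T := [set p : V * V * V | triangle (adj G) p.1.1 p.1.2 p.2].
have neq := edge_neq (adj_irr G).
have -> : ordered_triangles (adj G) = #|T|.
  rewrite /ordered_triangles /sum3 pair_big pair_big /= -sum1_card [RHS]big_mkcond /=.
  by apply: eq_bigr => -[[x y] z] _ /=; rewrite inE.
have trT p : p \in T -> tr p \in cliques 3.
  case: p => [[x y] z]; rewrite inE /= => t; have /and3P[xy yz xz] := t.
  have := pairs_of_triple (neq _ _ xy) (neq _ _ yz) (neq _ _ xz); rewrite t inE => ->.
  by rewrite /tr /= -setUA cardsU1 cards2 !inE negb_or !neq.
rewrite card_copies_complete_graph -sum1_card (partition_big tr (mem (cliques 3))) //=.
rewrite mulnC -sum_nat_const; apply: eq_bigr => P cP.
have [x [y [z [xy yz xz PE]]]] : exists x y z, [/\ x != y, y != z, x != z & P = [set x; y; z]].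
  move: cP; rewrite inE => /andP[/eqP P3 _].
  have /card_gt0P[x xP] : 0 < #|P| by rewrite P3.
  have /cards2P[y [z [yz PE]]] : #|P :\ x| == 2.
    by have := cardsD1 x P; rewrite xP P3; lia.
  have : (y \in P :\ x) && (z \in P :\ x) by rewrite PE !inE !eqxx orbT.
  rewrite !in_setD1 => /andP[/andP[yx _] /andP[zx _]].
  exists x, y, z; split=> //; rewrite 1?eq_sym //.
  by rewrite -setUA -PE setD1K.
rewrite -(triple_fiber xy yz xz) -sum1_card; apply: eq_bigl => p; rewrite inE PE.
rewrite andb_idl // => /eqP trp; case: p trp => [[a b] c]; rewrite /tr /= => trp.
have abc : (a != b) && (b != c) && (a != c).
  have : #|P| = 3 by move: cP; rewrite inE => /andP[/eqP].
  rewrite PE -trp -setUA cardsU1 cards2 !inE.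
  by case: (a == b); case: (b == c); case: (a == c).
case/andP: abc => /andP[ab bc] ac; rewrite inE /= -pairs_of_triple // trp -PE.
by move: cP; rewrite inE => /andP[].
Qed.
End Cliques.

(** * The edge blow-up of the triangle is the sun *)

Section Sun.
Variables (V : finType) (G : sgraph V).

Lemma edges_cycle3 : edges (cycle_graph 3) = pairs_of setT.
Proof.
rewrite -edges_complete_graph; apply/setP => e; apply/idP/idP => /edges_pair[i [j [ij -> _]]].
  by rewrite -[_ \in _]/(adj (complete_graph 3) i j) adj_graph_of ij.
rewrite -[_ \in _]/(adj (cycle_graph 3) i j) adj_graph_of ij.
by move: ij; case: i => -[|[|[|//]]] ?; case: j => -[|[|[|//]]] ?.
Qed.

Lemma opposite_edge_subproof (i : 'I_3) : ~: [set i] \in edges (cycle_graph 3).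
Proof. by rewrite edges_cycle3 inE subsetT andbT cardsC1 card_ord. Qed.

(** In a triangle, edges are indexed by the vertex that they avoid. *)
Definition opposite_edge (i : 'I_3) : {e | e \in edges (cycle_graph 3)} :=
  exist (fun e : {set 'I_3} => e \in edges (cycle_graph 3)) _ (opposite_edge_subproof i).

Definition blowup_tip (i : 'I_3) : blowup_vertex 3 (cycle_graph 3) :=
  inr (opposite_edge i, ord0).

Definition blowup_base (i : 'I_3) : blowup_vertex 3 (cycle_graph 3) := inl i.

Lemma opposite_edge_inj : injective opposite_edge.
Proof.
by move=> i j [] /setC_inj/set1_inj.
Qed.

Lemma blowup_vertexP (u : blowup_vertex 3 (cycle_graph 3)) :
  (exists i, u = blowup_base i) \/ (exists i, u = blowup_tip i).
Proof.
case: u => [i|[[e eC] k]]; [by left; exists i|right].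
have : #|~: e| == 1.
  have := eC; rewrite edges_cycle3 inE => /andP[/eqP e2 _].
  by have := cardsC e; rewrite card_ord e2; lia.
case/cards1P=> i ei; exists i; congr inr; congr pair; last by rewrite [k]ord1.
by apply: val_inj; rewrite /= -ei setCK.
Qed.

Lemma adj_blowup_tip i j : i != j ->
  adj (blowup 3 (cycle_graph 3)) (blowup_base i) (blowup_tip j).
Proof.
move=> ij; rewrite adj_graph_of /=; apply/orP; left.
by apply/existsP; exists (opposite_edge j); rewrite !inE /= !inE ij eqxx.
Qed.

Lemma adj_blowup_base i j : i != j ->
  adj (blowup 3 (cycle_graph 3)) (blowup_base i) (blowup_base j).
Proof.
move=> ij; rewrite adj_graph_of /= (inj_eq (@inl_inj _ _)) ij; apply/orP; left.
have [k /andP[ik jk]] : exists k, (i != k) && (j != k).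
  have /card_gt0P[k] : 0 < #|~: [set i; j]|.
    by have := cardsC [set i; j]; rewrite cards2 ij card_ord; lia.
  by rewrite !inE negb_or [k == i]eq_sym [k == j]eq_sym; exists k.
by apply/existsP; exists (opposite_edge k); rewrite !inE /= !inE ik jk.
Qed.

Lemma adj_blowup_tips i j : ~~ adj (blowup 3 (cycle_graph 3)) (blowup_tip i) (blowup_tip j).
Proof.
apply/negP; rewrite adj_graph_of => /andP[ij].
have no a b : a != b -> ~~ [exists e, (blowup_tip a \in blowup_clique 3 e) &&
   (blowup_tip b \in blowup_clique 3 e)].
  move=> ab; apply/existsP => -[e]; rewrite !inE /= => /andP[/eqP ae /eqP be].
  by case/eqP: ab; apply: opposite_edge_inj; rewrite ae be.
have {}ij : i != j by apply: contraNneq ij => ->.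
by rewrite (negPf (no i j ij)) (negPf (no j i _)) // eq_sym.
Qed.

Lemma adj_blowup_tip_inv i j :
  adj (blowup 3 (cycle_graph 3)) (blowup_base i) (blowup_tip j) -> i != j.
Proof.
rewrite adj_graph_of /= => /orP[] /existsP[e]; rewrite !inE /= => /andP[].
  by move=> ie /eqP je; move: ie; rewrite -je !inE.
by move=> /eqP je; rewrite -je !inE.
Qed.

(** The base vertices i and the tips j of the blow-up are adjacent exactly when i
    and j differ, and two tips never are, so an embedding amounts to the six
    vertices of a sun. *)
Lemma is_free_sunP : reflect (sun_free (adj G)) (is_free (blowup 3 (cycle_graph 3)) G).
Proof.
apply: (iffP (is_freeP _ _)) => free.
  move=> x y z x' y' z' un gxy gyz gxz; rewrite !inE.
  move=> /andP[gyx' gzx'] /andP[gxy' gzy'] /andP[gxz' gyz'].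
  pose s := [:: x; y; z; x'; y'; z'].
  pose tip_index (e : {set 'I_3}) := odflt ord0 [pick i | i \notin e].
  pose f (u : blowup_vertex 3 (cycle_graph 3)) : V :=
    match u with inl i => nth x s i | inr v => nth x s (3 + tip_index (val v.1)) end.
  have f_tip j : f (blowup_tip j) = nth x s (3 + j).
    rewrite /f /tip_index /=; case: pickP => [k|/(_ j)]; rewrite !inE ?negbK ?eqxx //.
    by move/eqP->.
  have f_base i : f (blowup_base i) = nth x s i by [].
  have symG := adj_sym G.
  have base i j : i != j -> adj G (nth x s (i : 'I_3)) (nth x s (j : 'I_3)).
    by case: i => -[|[|[|//]]] ?; case: j => -[|[|[|//]]] ? //= _; rewrite // symG.
  have tip i j : i != j -> adj G (nth x s (i : 'I_3)) (nth x s (3 + (j : 'I_3))).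
    by case: i => -[|[|[|//]]] ?; case: j => -[|[|[|//]]] ? //= _; rewrite // symG.
  have lt3 (i : 'I_3) : i < 6 by apply: leq_trans (ltn_ord i) _.
  have lt6 (i : 'I_3) : 3 + i < 6 by rewrite -[6]/(3 + 3) ltn_add2l.
  apply: (free f).
    move=> u v; case: (blowup_vertexP u) => -[i ->]; case: (blowup_vertexP v) => -[j ->];
      rewrite ?f_base ?f_tip => /eqP; rewrite nth_uniq // => /eqP.
    - by move/ord_inj->.
    - by move=> ij; have := ltn_ord i; rewrite ij.
    - by move=> ij; have := ltn_ord j; rewrite -ij.
    - by move/addnI/ord_inj->.
  move=> u v; case: (blowup_vertexP u) => -[i ->]; case: (blowup_vertexP v) => -[j ->];
    rewrite ?f_base ?f_tip => uv.
  - by apply: base; apply: contraTneq uv => ->; rewrite adj_irr.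
  - by apply: tip; apply: adj_blowup_tip_inv.
  - by rewrite symG; apply: tip; apply: adj_blowup_tip_inv; rewrite adj_sym.
  - by rewrite (negPf (adj_blowup_tips i j)) in uv.
move=> f inj_f hom_f.
pose i0 : 'I_3 := @Ordinal 3 0 isT; pose i1 : 'I_3 := @Ordinal 3 1 isT.
pose i2 : 'I_3 := @Ordinal 3 2 isT.
apply: (free (f (blowup_base i0)) (f (blowup_base i1)) (f (blowup_base i2))
  (f (blowup_tip i0)) (f (blowup_tip i1)) (f (blowup_tip i2))); rewrite ?inE;
  rewrite ?hom_f //; try exact: adj_blowup_base; try exact: adj_blowup_tip.
pose s := [:: i0; i1; i2].
rewrite -[X in uniq X]/(map f (map blowup_base s ++ map blowup_tip s)).
rewrite map_inj_uniq // cat_uniq !map_inj_uniq.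
- by apply/and3P; split=> //; apply/hasPn => _ /mapP[i _ ->]; apply/mapP => -[].
- by move=> i j [] /setC_inj/set1_inj.
- by move=> i j [].
Qed.
End Sun.

(** * The candidate extremal graphs *)

Section Extremal.

Definition join_of_matchings (p q : nat) :=
  join_graph (matching_graph p) (matching_graph q).

Lemma adj_matching p (x y : 'I_p * bool) :
  adj (matching_graph p) x y = (x != y) && (x.1 == y.1).
Proof. by rewrite adj_graph_of eq_sym [y.1 == _]eq_sym orbb. Qed.

Lemma adj_join_ll (V W : finType) (G : sgraph V) (H : sgraph W) a b :
  adj (join_graph G H) (inl a) (inl b) = adj G a b.
Proof.
rewrite adj_graph_of (inj_eq (@inl_inj _ _)) (adj_sym G b a) orbb.
by have [->|] := eqVneq a b; rewrite ?adj_irr.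
Qed.

Lemma adj_join_rr (V W : finType) (G : sgraph V) (H : sgraph W) a b :
  adj (join_graph G H) (inr a) (inr b) = adj H a b.
Proof.
rewrite adj_graph_of (inj_eq (@inr_inj _ _)) (adj_sym H b a) orbb.
by have [->|] := eqVneq a b; rewrite ?adj_irr.
Qed.

Lemma adj_join_lr (V W : finType) (G : sgraph V) (H : sgraph W) a b :
  adj (join_graph G H) (inl a) (inr b).
Proof. by rewrite adj_graph_of. Qed.

Definition left_part (V W : finType) : {set V + W} := inl @: setT.

Lemma mem_left_part (V W : finType) (u : V + W) :
  (u \in left_part V W) = if u is inl _ then true else false.
Proof.
case: u => a; first by rewrite imset_f.
by apply/imsetP => -[].
Qed.

Lemma card_left_part (V W : finType) :
  #|left_part V W| = #|V| /\ #|~: left_part V W| = #|W|.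
Proof.
have cL : #|left_part V W| = #|V| by rewrite card_imset ?cardsT //; exact: inl_inj.
by split=> //; have := cardsC (left_part V W); rewrite cL card_sum; lia.
Qed.

Lemma matching_neighbour p (x y : 'I_p * bool) :
  adj (matching_graph p) x y = (y == (x.1, ~~ x.2)).
Proof.
rewrite adj_matching; case: x y => [i b] [j c] /=; rewrite !xpair_eqE [j == i]eq_sym.
by case: (i == j); case: b; case: c.
Qed.

Lemma matching_join_join_of_matchings p q :
  matching_join (adj (join_of_matchings p q)) (left_part _ _).
Proof.
split=> [x y|x|x]; rewrite ?mem_left_part.
- by case: x => // a; case: y => // b _ _; rewrite adj_join_lr.
- case: x => // a _; rewrite /inner_degree sum_row_card.
  rewrite -(cards1 (inl (a.1, ~~ a.2) : 'I_p * bool + 'I_q * bool)); congr #|pred_of_set _|.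
  apply/setP => -[b|b]; rewrite !inE mem_left_part //= adj_join_ll matching_neighbour.
  by rewrite (inj_eq (@inl_inj _ _)).
- case: x => // a _; rewrite /inner_degree sum_row_card.
  rewrite -(cards1 (inr (a.1, ~~ a.2) : 'I_p * bool + 'I_q * bool)); congr #|pred_of_set _|.
  apply/setP => -[b|b]; rewrite !inE mem_left_part //= adj_join_rr matching_neighbour.
  by rewrite (inj_eq (@inr_inj _ _)).
Qed.

Lemma matching_joinC (V : finType) (G : sgraph V) A :
  matching_join (adj G) A -> matching_join (adj G) (~: A).
Proof.
case=> cross dA dB; split=> [x y|x|x]; rewrite ?inE ?setCK ?negbK; last exact: dA.
  by move=> xA yA; rewrite adj_sym cross.
exact: dB.
Qed.

Lemma matching_join_preim (V W : finType) (G : sgraph V) (f : W -> V) A :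
    bijective f -> matching_join (adj G) A ->
  matching_join (adj (graph_of (fun x y => adj G (f x) (f y)))) (f @^-1: A).
Proof.
move=> bij_f [cross dA dB]; set G' := graph_of _.
have adjE x y : adj G' x y = adj G (f x) (f y).
  rewrite adj_graph_of (adj_sym G (f y)) orbb.
  by have [->|] := eqVneq x y; rewrite ?adj_irr.
have degE (B : {set V}) x : inner_degree (adj G') (f @^-1: B) x = inner_degree (adj G) B (f x).
  rewrite /inner_degree [RHS](reindex f) /=; last exact: onW_bij.
  by apply: eq_big => [y|y _]; rewrite ?inE ?adjE.
split=> [x y|x|x]; rewrite ?inE.
- by move=> xA yA; rewrite adjE cross.
- by move=> xA; rewrite degE dA.
- by move=> xA; rewrite -preimsetC degE dB.
Qed.

Lemma card_copies_matching_join (V : finType) (G : sgraph V) A :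
  matching_join (adj G) A -> #|copies (complete_graph 3) G| = #|A| * #|~: A|.
Proof.
move=> mA; have noT := matching_join_no_inner_triangle (adj_irr G) mA.
have := ordered_triangles_cross (adj_sym G) noT.
rewrite ordered_triangles_copies cross_weight_matching_join //; last exact: adj_sym.
lia.
Qed.

Lemma matching_join_is_free (V : finType) (G : sgraph V) A :
  matching_join (adj G) A -> is_free (blowup 3 (cycle_graph 3)) G.
Proof.
by move=> mA; apply/is_free_sunP; apply: (matching_join_sun_free _ _ mA);
  [exact: adj_sym|exact: adj_irr].
Qed.

(** The coordinates of the two perfect matchings combine into an isomorphism, as
    all cross pairs are edges on both sides. *)
Lemma matching_join_isomorphic (V : finType) (G : sgraph V) A p q :
    0 < p -> 0 < q -> matching_join (adj G) A -> #|A| = p.*2 -> #|~: A| = q.*2 ->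
  isomorphic G (join_of_matchings p q).
Proof.
move=> p0 q0 [cross dA dB] cA cB.
have coords (B : {set V}) r : 0 < r -> #|B| = r.*2 ->
    (forall x, x \in B -> inner_degree (adj G) B x = 1) ->
  exists f : V -> 'I_r * bool, {in B &, injective f} /\
    {in B &, forall x y, adj G x y = adj (matching_graph r) (f x) (f y)}.
  move=> r0 cB' dB'; have B0 : B != set0 by rewrite -card_gt0 cB' double_gt0.
  have [r' [cr' [f [inj_f adj_f]]]] :=
    perfect_matching_coordinates (adj_sym G) (adj_irr G) B0 dB'.
  have rr' : r' = r by apply: double_inj; rewrite -cr' -cB'.
  subst r'; exists f; split=> // x y xB yB; rewrite adj_f // adj_matching.
  by rewrite (inj_in_eq inj_f).
have [f [inj_f adj_f]] := coords A p p0 cA dA.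
have [h [inj_h adj_h]] : exists h : V -> 'I_q * bool, {in ~: A &, injective h} /\
    {in ~: A &, forall x y, adj G x y = adj (matching_graph q) (h x) (h y)}.
  by apply: coords => // x; rewrite inE; exact: dB.
pose F x : 'I_p * bool + 'I_q * bool := if x \in A then inl (f x) else inr (h x).
exists F; last first.
  move=> x y; rewrite /F; case: ifPn => xA; case: ifPn => yA.
  - by rewrite adj_join_ll adj_f.
  - by rewrite adj_join_lr cross.
  - by rewrite [LHS]adj_sym [RHS]adj_sym adj_join_lr cross.
  - by rewrite adj_join_rr adj_h ?inE.
apply: inj_card_bij.
  move=> x y; rewrite /F; case: ifPn => xA; case: ifPn => yA // [].
    exact: inj_f.
  by apply: inj_h; rewrite inE.
rewrite card_sum !card_prod !card_ord card_bool -(cardsC A) cA cB; lia.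
Qed.
End Extremal.

(** * The generalized Turan number *)

(** The parts have even sizes 2p and 2q, and t = 4pq >= (p + q)^2 - 1 forces p and q
    to differ by at most one. *)
Lemma many_triangles_structure (V : finType) (G : sgraph V) : 22 <= #|V| ->
    is_free (blowup 3 (cycle_graph 3)) G ->
    #|V| ^ 2 <= 4 * #|copies (complete_graph 3) G| + 4 ->
  exists p q, [/\ q <= p <= q.+1, #|V| = (p + q).*2,
    #|copies (complete_graph 3) G| = p.*2 * q.*2 &
    isomorphic G (join_of_matchings p q)].
Proof.
move=> n22 /is_free_sunP free many.
have symG := adj_sym G; have irrG := adj_irr G.
have [A mA] : exists A, matching_join (adj G) A.
  apply: many_triangles_matching_join => //.
  by rewrite ordered_triangles_copies; lia.
wlog le_BA : A mA / #|~: A| <= #|A|.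
  move=> wl; have [|/ltnW] := leqP #|~: A| #|A|; first exact: wl.
  by move=> le; apply: (wl (~: A)); rewrite ?setCK //; exact: matching_joinC.
have cardG := card_copies_matching_join mA.
have cardAB : #|A| + #|~: A| = #|V| by rewrite cardsC.
rewrite cardG -cardAB in many.
have B0 : 0 < #|~: A|.
  rewrite lt0n; apply: contraTneq many => B0; rewrite B0 in cardAB *.
  by rewrite muln0 addn0 -ltnNge -mulnn; nia.
have A0 : 0 < #|A| by apply: leq_trans le_BA.
case: (mA) => _ dA dB.
have [|p [cA _]] := perfect_matching_coordinates symG irrG _ dA; first by rewrite -card_gt0.
have [|x|q [cB _]] := @perfect_matching_coordinates _ _ symG irrG (~: A).
- by rewrite -card_gt0.
- by rewrite inE; exact: dB.
rewrite cA cB in many le_BA A0 B0 cardAB cardG *.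
have pq : p <= q.+1.
  rewrite leqNgt; apply/negP => qp.
  have [r rE] : exists r, p = q + 2 + r by exists (p - q - 2); lia.
  move: many; rewrite rE -!mul2n -!mulnn; nia.
exists p, q; split=> //; rewrite ?cardG //.
- by move: le_BA; rewrite leq_double pq => ->.
- by rewrite -cardAB doubleD.
- by apply: matching_join_isomorphic mA cA cB; rewrite -double_gt0.
Qed.

(** Here n^2 = 4 (p + q)^2 = 16 p q + 4 (p - q)^2, and 4 divides n exactly when
    p = q. *)
Lemma balanced_halves n p q : q <= p <= q.+1 -> n = (p + q).*2 ->
  [/\ p = (n + 3) %/ 4, q = n %/ 4 & n ^ 2 + 4 * (4 %| n) = 4 * (p.*2 * q.*2) + 4].
Proof.
move=> /andP[qp pq] ->; split; [lia|lia|].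
have [->|->] : p = q \/ p = q.+1 by lia.
  have -> : 4 %| (q + q).*2 by lia.
  by rewrite -!mul2n -!mulnn; lia.
have -> : 4 %| (q.+1 + q).*2 = false by lia.
by rewrite -!mul2n -!mulnn; lia.
Qed.

Lemma gen_turan_ge n (U W : finType) (T : sgraph U) (H : sgraph W) (G : sgraph 'I_n) :
  is_free H G -> #|copies T G| <= gen_turan n T H.
Proof. by move=> freeG; apply: leq_bigmax_cond. Qed.

(** A graph reaching n^2 / 4 - 1 is a balanced join of matchings, whose number of
    triangles is known.  The bound is multiplied by 4 to stay in the natural
    numbers. *)
Lemma gen_turan_bound n : 22 <= n ->
  4 * gen_turan n (complete_graph 3) (blowup 3 (cycle_graph 3)) + 4 <= n ^ 2 + 4 * (4 %| n).
Proof.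
move=> n22; set ex := gen_turan _ _ _.
suff le : ex <= (n ^ 2 + 4 * (4 %| n) - 4) %/ 4.
  have : 4 <= n ^ 2 + 4 * (4 %| n) by rewrite -mulnn; nia.
  move: (n ^ 2 + _) le => r; lia.
apply/bigmax_leqP => G freeG.
have [small|many] := ltnP (4 * #|copies (complete_graph 3) G| + 4) (n ^ 2).
  by move: small; move: (n ^ 2) (4 %| n) => r b; lia.
have cardI := card_ord n.
have [||p [q [pq nE cE _]]] := many_triangles_structure _ freeG; rewrite ?cardI //.
by have [_ _ ->] := balanced_halves pq (etrans (esym cardI) nE); rewrite cE; lia.
Qed.

Lemma join_of_matchings_card p q :
  [/\ #|{: 'I_p * bool + 'I_q * bool}| = (p + q).*2,
      is_free (blowup 3 (cycle_graph 3)) (join_of_matchings p q) &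
      #|copies (complete_graph 3) (join_of_matchings p q)| = p.*2 * q.*2].
Proof.
have mM := matching_join_join_of_matchings p q.
split; first by rewrite card_sum !card_prod !card_ord card_bool; lia.
  exact: matching_join_is_free mM.
rewrite (card_copies_matching_join mM).
have [-> ->] := card_left_part ('I_p * bool)%type ('I_q * bool)%type.
by rewrite !card_prod !card_ord card_bool -!muln2.
Qed.

(** The maximum ranges over graphs on ordinals, so the join of matchings is first
    transported along an enumeration of its vertices. *)
Lemma join_of_matchings_gen_turan p q (n := (p + q).*2) :
  p.*2 * q.*2 <= gen_turan n (complete_graph 3) (blowup 3 (cycle_graph 3)).
Proof.
have mM := matching_join_join_of_matchings p q.
have [cV _ <-] := join_of_matchings_card p q.
pose f (i : 'I_n) : ('I_p * bool) + ('I_q * bool) := enum_val (cast_ord (esym cV) i).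
have bij_f : bijective f.
  apply: inj_card_bij; last by rewrite cV card_ord.
  by move=> i j /enum_val_inj/cast_ord_inj.
have mG := matching_join_preim bij_f mM.
apply: leq_trans (gen_turan_ge _ (matching_join_is_free mG)).
rewrite (card_copies_matching_join mM) (card_copies_matching_join mG).
by rewrite -preimsetC !(@on_card_preimset _ _ f) //; exact: onW_bij.
Qed.

Import Order.TTheory GRing.Theory Num.Theory.
Local Open Scope ring_scope.

(* (n + 3) %/ 4 is the ceiling of n / 4. *)
Theorem theorem2 (n : nat) (hn : (22 <= n)%N) :
  let C33 := blowup 3 (cycle_graph 3) in
  let exn := gen_turan n (complete_graph 3) C33 in
  let bound : rat := n%:R ^+ 2 / 4%:R - 1 + (4 %| n)%N%:R in
  let M := join_graph (matching_graph ((n + 3) %/ 4)) (matching_graph (n %/ 4)) in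
  (exn%:R <= bound) /\
  (~~ odd n ->
    [/\ exn%:R = bound,
        extremal n (complete_graph 3) C33 M &
        forall (V : finType) (G : sgraph V),
          extremal n (complete_graph 3) C33 G -> isomorphic G M]).
Proof.
move=> C33 exn bound M.
have ub : (4 * exn + 4 <= n ^ 2 + 4 * (4 %| n))%N by exact: gen_turan_bound.
have bound4 : 4%:R * bound + 4%:R = (n ^ 2 + 4 * (4 %| n))%:R.
  by rewrite /bound natrD natrM natrX; field.
split.
  rewrite -(@ler_pM2l _ 4%:R) // -(lerD2r 4%:R) bound4.
  by rewrite -natrM -natrD ler_nat.
move=> n_even; pose p := ((n + 3) %/ 4)%N; pose q := (n %/ 4)%N.
have nE : n = (p + q).*2 by rewrite /p /q; lia.
have pq : (q <= p <= q.+1)%N by rewrite /p /q; lia.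
have [_ _ numE] := balanced_halves pq nE.
have exE : exn = (p.*2 * q.*2)%N.
  apply/eqP; rewrite eqn_leq; apply/andP; split.
    by move: ub; rewrite numE leq_add2r leq_pmul2l.
  by have := join_of_matchings_gen_turan p q; rewrite -nE.
have [cM freeM copiesM] := join_of_matchings_card p q.
split.
- apply: (mulfI (_ : 4%:R != 0 :> rat)) => //; apply: (addIr 4%:R).
  by rewrite bound4 numE -exE natrD natrM.
- by split=> //; [exact: etrans cM (esym nE)|exact: etrans copiesM (esym exE)].
move=> V G [cV freeG copiesG].
have [||p' [q' [pq' nE' _ iso]]] := many_triangles_structure _ freeG.
- by rewrite cV.
- by rewrite cV copiesG -/exn exE -numE; lia.
rewrite cV in nE'; have [pE qE _] := balanced_halves pq' nE'.
by rewrite /M -pE -qE.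
Qed.
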